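(* If $M$ is a second countable complex manifold and $F$ is a Banach space, then $(\mathcal O^F(M),\tau_\delta)$ is sequentially complete.
   Context: $M$ is modeled on Banach spaces; $\mathcal O^F(M)$ is the space of holomorphic maps $M\to F$. For a countable open cover $\mathfrak U=\{U_i\}_{i\in\mathbb N}$ of $M$, $\mathcal O^F(\mathfrak U)=\{f\in\mathcal O^F(M):\sup_{U_i}\|f\|<\infty\ \forall i\}$ is a Fréchet space with the seminorms $\sup_{U_i}\|f\|$; the $\tau_\delta$ (countable cover) topology on $\mathcal O^F(M)$ is the finest locally convex topology making all inclusions $\mathcal O^F(\mathfrak U)\hookrightarrow\mathcal O^F(M)$ continuous. *)

(* Defs.v *)
From HB Require Import structures.
From mathcomp Require Import all_boot all_order all_algebra.
From mathcomp Require Import all_classical all_reals all_analysis.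
From mathcomp Require Import complex.

Set Implicit Arguments.
Unset Strict Implicit.
Unset Printing Implicit Defensive.

Import Order.TTheory GRing.Theory Num.Theory.
Import numFieldNormedType.Exports.
Local Open Scope classical_set_scope.
Local Open Scope ring_scope.

Section Defs.
Variable R : realType.
Local Notation C := (R[i]).

Definition holomorphic_on (E F : normedModType C) (D : set E) (g : E -> F) :=
  forall x, D x -> differentiable g x.

Record cBanachManifold (M : topologicalType) := CBanachManifold {
  chart_idx : Type;
  model : chart_idx -> completeNormedModType C;
  dom : chart_idx -> set M;
  chart : forall i, M -> model i;
  dom_open : forall i, open (dom i);
  dom_cover : forall x : M, exists i, dom i x;
  chart_inj : forall i, set_inj (dom i) (chart i);
  chart_cont : forall i, {within dom i, continuous (chart i)};
  chart_open : forall i (W : set M), open W -> W `<=` dom i -> open (chart i @` W);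
  transition_hol : forall i j, exists g : model i -> model j,
     holomorphic_on (chart i @` (dom i `&` dom j)) g /\
     (forall p, dom i p -> dom j p -> g (chart i p) = chart j p)
}.

Section Functions.
Variables (M : topologicalType) (A : cBanachManifold M) (F : completeNormedModType C).

Definition holo_map (f : M -> F) : Prop :=
  forall i : chart_idx A, exists g : model i -> F,
    holomorphic_on (chart i @` dom i) g /\
    (forall p, dom i p -> g (chart i p) = f p).

(* sup_{U} ||f||, as an extended real; the norm of F takes values in C
   (with zero imaginary part), complex.Re gives it as a real number *)
Definition supnorm (U : set M) (f : M -> F) : \bar R :=
  ereal_sup [set (complex.Re `|f x|)%:E | x in U].

Definition countable_open_cover (U : nat -> set M) : Prop :=
  (forall k, open (U k)) /\ (forall x : M, exists k, U k x).

Definition holo_bdd (U : nat -> set M) (f : M -> F) : Prop :=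
  holo_map f /\ forall k, (supnorm (U k) f < +oo)%E.

Definition seminorm_on_holo (p : (M -> F) -> R) : Prop :=
  [/\ forall f, holo_map f -> 0 <= p f,
      forall f g, holo_map f -> holo_map g -> p (f \+ g) <= p f + p g &
      forall (a : C) f, holo_map f -> p (fun x => a *: f x) = Normc.normc a * p f].

(* The locally convex topology tau_delta is the finest locally convex topology
   on O^F(M) for which every inclusion O^F(U) -> O^F(M) is continuous, U a
   countable open cover, O^F(U) carrying its Frechet topology given by the
   seminorms sup_{U_k} ||f||.  Its continuous seminorms are exactly the seminorms
   p on O^F(M) whose restriction to each O^F(U) is continuous (at 0, i.e.
   bounded by eps on some basic neighbourhood {f | sup_{U_k}||f|| < delta, k < n}). *)
Definition tau_delta_seminorm (p : (M -> F) -> R) : Prop :=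
  seminorm_on_holo p /\
  forall U : nat -> set M, countable_open_cover U ->
  forall eps : R, 0 < eps -> exists (n : nat) (delta : R), 0 < delta /\
    forall f, holo_bdd U f ->
      (forall k, (k < n)%N -> (supnorm (U k) f < delta%:E)%E) -> p f < eps.

Definition tau_delta_cauchy (u : nat -> M -> F) : Prop :=
  (forall n, holo_map (u n)) /\
  forall p, tau_delta_seminorm p -> forall eps : R, 0 < eps ->
    exists N : nat, forall m n, (N <= m)%N -> (N <= n)%N -> p (u m \- u n) < eps.

Definition tau_delta_converges (u : nat -> M -> F) (f : M -> F) : Prop :=
  holo_map f /\
  forall p, tau_delta_seminorm p -> forall eps : R, 0 < eps ->
    exists N : nat, forall n, (N <= n)%N -> p (u n \- f) < eps.

Definition tau_delta_sequentially_complete : Prop :=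
  forall u : nat -> M -> F, tau_delta_cauchy u -> exists f, tau_delta_converges u f.
End Functions.
End Defs.

(* Main.v *)
(** A Cauchy sequence (u_n) for tau_delta is Cauchy for every tau_delta-continuous
    seminorm, in particular for the following two kinds. The supremum of |f| over
    a convergent sequence of points and its limit is one; since M is first
    countable, this forces (u_n) to be locally uniformly bounded. The norm of the
    j-th Taylor coefficient at a point of a chart, taken over the lines through
    that point, is another, by the Cauchy estimate on arbitrarily small balls.
    The low order Taylor coefficients of u_m - u_n are therefore small, the
    remainder is geometrically small by local boundedness, and (u_n) is locally
    uniformly Cauchy. Its limit f is holomorphic by Weierstrass' theorem. As M is
    Lindelof, there is one countable open cover on whose members the u_n are
    bounded and converge uniformly, so u_n - f tends to 0 in the Frechet space of
    that cover, hence in tau_delta.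

    The Cauchy estimate for vector-valued functions is obtained without integrals,
    from Goursat's bisection applied to finite dyadic sums along segments. *)
Require Import Defs.
From HB Require Import structures.
From mathcomp Require Import all_boot all_order all_algebra.
From mathcomp Require Import all_classical all_reals all_analysis.
From mathcomp Require Import complex.
From mathcomp Require Import ring lra.

Set Implicit Arguments.
Unset Strict Implicit.
Unset Printing Implicit Defensive.

Import Order.TTheory GRing.Theory Num.Theory.
Import numFieldNormedType.Exports.
Local Open Scope classical_set_scope.
Local Open Scope ring_scope.
Local Open Scope complex_scope.

(** * Real-valued norms, bisection and the mean value inequality *)

Inductive mexp (K : Type) :=
  | MVar of nat | MZero | MAdd of mexp K & mexp K | MOpp of mexp K
  | MScale of K & mexp K.
Arguments MVar {K}. Arguments MZero {K}.

Section Module.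
Variables (K : comNzRingType) (V : lmodType K).

Fixpoint meval (env : seq V) (e : mexp K) : V :=
  match e with
  | MVar n => nth 0 env n | MZero => 0
  | MAdd a b => meval env a + meval env b
  | MOpp a => - meval env a
  | MScale k a => k *: meval env a
  end.

(** Atoms are compared with [Nat.eqb], which [cbn] evaluates on numerals, so that only scalar
    expressions remain in the goals passed to [ring] or [field]. *)
Fixpoint mcoef (e : mexp K) (i : nat) : K :=
  match e with
  | MVar n => if Nat.eqb n i then 1 else 0 | MZero => 0
  | MAdd a b => mcoef a i + mcoef b i
  | MOpp a => - mcoef a i
  | MScale k a => k * mcoef a i
  end.

Fixpoint mcoef_eq (n : nat) (a b : mexp K) : Prop :=
  if n is n'.+1 then mcoef a n' = mcoef b n' /\ mcoef_eq n' a b else True.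

Lemma mevalE env e : meval env e = \sum_(i < size env) mcoef e i *: env`_i.
Proof.
elim: e => [n||a IHa b IHb|a IHa|k a IHa] /=.
- have [n_lt|n_ge] := ltnP n (size env).
    rewrite (bigD1 (Ordinal n_lt)) //= PeanoNat.Nat.eqb_refl scale1r big1 ?addr0 // => i /eqP ni.
    case: PeanoNat.Nat.eqb_spec => [e|_]; last by rewrite scale0r.
    by case: ni; apply: val_inj.
  rewrite nth_default // big1 // => i _.
  case: PeanoNat.Nat.eqb_spec => [e|_]; last by rewrite scale0r.
  by move: n_ge (ltn_ord i); rewrite e leqNgt => /negP.
- by rewrite big1 // => i _; rewrite scale0r.
- by rewrite IHa IHb -big_split; apply: eq_bigr => i _; rewrite scalerDl.
- by rewrite IHa -sumrN; apply: eq_bigr => i _; rewrite scaleNr.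
- by rewrite IHa scaler_sumr; apply: eq_bigr => i _; rewrite scalerA.
Qed.

Lemma meval_eq env a b : mcoef_eq (size env) a b -> meval env a = meval env b.
Proof.
rewrite !mevalE => h; apply: eq_bigr => -[i /= ilt] _; congr (_ *: _).
elim: (size env) ilt h => //= n IH; rewrite ltnS leq_eqVlt => /orP[/eqP->|/IH h] [] // _.
Qed.
End Module.

Ltac mod_index x l :=
  lazymatch l with
  | x :: _ => constr:(O)
  | _ :: ?t => let n := mod_index x t in constr:(S n)
  end.
Ltac mod_mem x l :=
  lazymatch l with
  | x :: _ => constr:(true)
  | _ :: ?t => mod_mem x t
  | _ => constr:(false)
  end.
Ltac mod_vars e l :=
  lazymatch e with
  | (?a + ?b)%R => let l' := mod_vars a l in mod_vars b l'
  | (- ?a)%R => mod_vars a l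
  | (_ *: ?a)%R => mod_vars a l
  | 0%R => l
  | _ => let m := mod_mem e l in
         lazymatch m with true => l | false => constr:(e :: l) end
  end.
Ltac mod_reify K e l :=
  lazymatch e with
  | (?a + ?b)%R => let a' := mod_reify K a l in let b' := mod_reify K b l in
                   constr:(@MAdd K a' b')
  | (- ?a)%R => let a' := mod_reify K a l in constr:(@MOpp K a')
  | (?k *: ?a)%R => let a' := mod_reify K a l in constr:(@MScale K k a')
  | 0%R => constr:(@MZero K)
  | _ => let n := mod_index e l in constr:(@MVar K n)
  end.
(* Decides linear identities in a module: the coefficients of each atom are
   compared with [ring] or [field]. *)
Tactic Notation "module_eq" constr(K) :=
  lazymatch goal with
  | |- @eq ?V ?a ?b =>
    let l0 := constr:(@nil V) in
    let l1 := mod_vars a l0 in let l := mod_vars b l1 in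
    let a' := mod_reify K a l in let b' := mod_reify K b l in
    change (@meval _ _ l a' = @meval _ _ l b');
    apply: meval_eq; cbn [mcoef_eq mcoef size Nat.eqb];
    repeat split; try ring; try (by field)
  end.

Section Norms.
Variable R : realType.
Local Notation C := R[i].

(** The modulus as a real number: the library norm takes values in [C], where [lra] does not apply.
    The same holds for [nrm] below. *)
Definition cabs (z : C) : R := Normc.normc z.

Lemma cabsE (z : C) : `|z| = (cabs z)%:C.
Proof. by rewrite normc_def; case: z. Qed.
Lemma cabs_ge0 z : 0 <= cabs z.
Proof. by rewrite -lecR -cabsE normr_ge0. Qed.
Lemma cabsM y z : cabs (y * z) = cabs y * cabs z.
Proof. exact: Normc.normcM. Qed.
Lemma cabsV z : cabs z^-1 = (cabs z)^-1.
Proof. exact: Normc.normcV. Qed.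
Lemma cabsD y z : cabs (y + z) <= cabs y + cabs z.
Proof. exact: (le_normcD (y : Rcomplex R)). Qed.
Lemma cabsN z : cabs (- z) = cabs z.
Proof. exact: (normcN (z : Rcomplex R)). Qed.
Lemma cabs0 : cabs 0 = 0. Proof. exact: Normc.normc0. Qed.
Lemma cabs1 : cabs 1 = 1. Proof. exact: Normc.normc1. Qed.
Lemma cabs_real (x : R) : cabs x%:C = `|x|.
Proof. by rewrite /cabs /= expr0n /= addr0 sqrtr_sqr. Qed.
Lemma cabs_eq0 z : cabs z = 0 -> z = 0.
Proof. exact: Normc.eq0_normc. Qed.
Lemma cabs_gt0 z : z != 0 -> 0 < cabs z.
Proof.
by rewrite lt_def cabs_ge0 andbT; apply: contra => /eqP/cabs_eq0/eqP.
Qed.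
Lemma cabs_nat n : cabs n%:R = n%:R.
Proof.
have -> : n%:R = (n%:R : R)%:C by rewrite rmorph_nat.
by rewrite cabs_real normr_nat.
Qed.
Lemma cabs_half z : cabs (z / 2) = cabs z / 2.
Proof. by rewrite cabsM cabsV cabs_nat. Qed.

Lemma complex_gt0 (e : C) : 0 < e -> e = (complex.Re e)%:C /\ 0 < complex.Re e.
Proof.
move=> e0; split; first by rewrite RRe_real // gtr0_real.
by move: e0; rewrite ltcE => /andP[].
Qed.

Variable V : normedModType C.

Definition nrm (x : V) : R := complex.Re `|x|.

Lemma nrmE x : `|x| = (nrm x)%:C.
Proof. by rewrite /nrm RRe_real // normr_real. Qed.
Lemma nrm_ge0 x : 0 <= nrm x.
Proof. by rewrite -lecR -nrmE normr_ge0. Qed.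
Lemma nrmD x y : nrm (x + y) <= nrm x + nrm y.
Proof. by rewrite -lecR rmorphD /= -!nrmE ler_normD. Qed.
Lemma nrmN x : nrm (- x) = nrm x.
Proof. by rewrite /nrm normrN. Qed.
Lemma nrmB x y : nrm (x - y) <= nrm x + nrm y.
Proof. by rewrite -(nrmN y) nrmD. Qed.
Lemma nrm0 : nrm 0 = 0. Proof. by rewrite /nrm normr0. Qed.
Lemma nrmZ (a : C) x : nrm (a *: x) = cabs a * nrm x.
Proof. by apply: complexI; rewrite rmorphM /= -!nrmE -cabsE normrZ. Qed.
Lemma nrm_eq0 x : nrm x = 0 -> x = 0.
Proof. by move=> h; apply: normr0_eq0; rewrite nrmE h. Qed.
Lemma nrmBC x y : nrm (x - y) = nrm (y - x).
Proof. by rewrite -nrmN opprB. Qed.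
Lemma nrm_triB x y z : nrm (x - z) <= nrm (x - y) + nrm (y - z).
Proof. by apply: le_trans (nrmD _ _); rewrite addrA subrK. Qed.
End Norms.

Section Bisection.
Variable R : realType.
Implicit Types (s t : R) (k : nat).

(** [P s t k] speaks of the dyadic square with lower corner (s, t) and side 2^-k. A property
    inherited by some quarter at each step holds on a nested sequence of squares shrinking to a
    point. *)
Lemma bisection (P : R -> R -> nat -> Prop) :
  P 0 0 0%N ->
  (forall s t k, P s t k ->
     exists a b : bool, P (s + a%:R * 2^-1 ^+ k.+1) (t + b%:R * 2^-1 ^+ k.+1) k.+1) ->
  exists s t, [/\ 0 <= s <= 1, 0 <= t <= 1 & forall k, exists s' t',
     [/\ P s' t' k, s' <= s <= s' + 2^-1 ^+ k & t' <= t <= t' + 2^-1 ^+ k]].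
Proof.
move=> P0 Pstep.
(* A square is packed with the proof of its property, so that choice yields a total successor map to
   iterate. *)
pose st := {q : R * R * nat | P q.1.1 q.1.2 q.2}.
have /choice[f fP] : forall q : st, exists q' : st, exists a b : bool,
    sval q' = (((sval q).1.1 + a%:R * 2^-1 ^+ (sval q).2.+1,
               (sval q).1.2 + b%:R * 2^-1 ^+ (sval q).2.+1), (sval q).2.+1).
  case=> -[[s t] k] /= Pq; have [a [b Pab]] := Pstep _ _ _ Pq.
  by exists (exist (fun q : R * R * nat => P q.1.1 q.1.2 q.2) ((_, _), _) Pab); exists a, b.
pose u n : st := iter n f (exist (fun q : R * R * nat => P q.1.1 q.1.2 q.2) ((0, 0), 0%N) P0).
have u2 n : (sval (u n)).2 = n.
  by elim: n => //= n IH; have [a [b ->]] := fP (u n); rewrite /= IH.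
have halfk_gt0 k : 0 < (2^-1 : R) ^+ k by apply: exprn_gt0; rewrite invr_gt0.
have lim (x : nat -> R) : x 0%N = 0 ->
    (forall n, exists a : bool, x n.+1 = x n + a%:R * 2^-1 ^+ n.+1) ->
    exists s, 0 <= s <= 1 /\ forall k, x k <= s <= x k + 2^-1 ^+ k.
  move=> x0 xS.
  have step n : x n <= x n.+1 /\ x n.+1 + 2^-1 ^+ n.+1 <= x n + 2^-1 ^+ n.
    have [a ->] := xS n; rewrite exprS; have := halfk_gt0 n.
    by case: a => /= h; split; lra.
  have up m n : (m <= n)%N -> x m <= x n /\ x n + 2^-1 ^+ n <= x m + 2^-1 ^+ m.
    elim: n => [|n IH]; first by rewrite leqn0 => /eqP ->.
    rewrite leq_eqVlt => /orP[/eqP->//|/IH[h1 h2]].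
    by have [h3 h4] := step n; split; [apply: le_trans h3|apply: le_trans h2].
  have ub k n : x n <= x k + 2^-1 ^+ k.
    case: (leqP n k) => [/up[h _]|/ltnW/up[_ h]]; have := halfk_gt0 k; have := halfk_gt0 n; lra.
  (* Each coordinate converges to the supremum of the lower corners. *)
  have sk k : x k <= sup (range x) <= x k + 2^-1 ^+ k.
    apply/andP; split.
      apply: ub_le_sup; last by exists k.
      by exists (x 0%N + 2^-1 ^+ 0) => _ [n _ <-]; apply: ub.
    by apply: ge_sup; [exists (x 0%N), 0%N|move=> _ [n _ <-]; apply: ub].
  exists (sup (range x)); split=> //.
  by have := sk 0%N; rewrite x0 expr0 add0r.
have [//|n|s [s01 sP]] := lim (fun n => (sval (u n)).1.1).
  by have [a [b /= ->]] := fP (u n); exists a; rewrite /= u2.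
have [//|n|t [t01 tP]] := lim (fun n => (sval (u n)).1.2).
  by have [a [b /= ->]] := fP (u n); exists b; rewrite /= u2.
exists s, t; split=> // k; exists (sval (u k)).1.1, (sval (u k)).1.2; split=> //.
by have := svalP (u k); rewrite u2.
Qed.

Lemma half_pow_lt (e : R) : 0 < e -> exists k, 2^-1 ^+ k < e.
Proof.
move=> e0; exists (Num.bound e^-1).
have lt := archi_boundP (ltW (eqbRL (invr_gt0 _) e0)).
have lt2 : (Num.bound e^-1)%:R < 2 ^+ (Num.bound e^-1) :> R.
  by rewrite -natrX ltr_nat ltn_expl.
rewrite exprVn invf_plt ?posrE ?exprn_gt0 //; exact: lt_trans lt2.
Qed.
End Bisection.

Section ComplexDerivative.
Variables (R : realType) (F : normedModType R[i]).
Local Notation C := R[i].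
Implicit Types (g : C -> F) (z w h : C) (l m : F).

(** The remainder is compared with e |h| without dividing by h, so the case h = 0 needs no
    exclusion. *)
Definition is_cd g z l := forall e : R, 0 < e -> exists2 d : R, 0 < d &
  forall h, cabs h < d -> nrm (g (z + h) - g z - h *: l) <= e * cabs h.

Lemma is_cd_unique g z l m : is_cd g z l -> is_cd g z m -> l = m.
Proof.
move=> gl gm; apply/eqP; rewrite -subr_eq0; apply/eqP/nrm_eq0/eqP.
rewrite eq_le nrm_ge0 andbT; apply/ler_addgt0Pr => e e0; rewrite add0r.
have e2 : 0 < e / 2 by lra.
have [d1 d10 h1] := gl _ e2; have [d2 d20 h2] := gm _ e2.
pose t := Num.min d1 d2 / 2.
have t0 : 0 < t by rewrite divr_gt0 // lt_min d10.
have tm : cabs (t%:C : C) = t by rewrite cabs_real gtr0_norm.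
have td : t < d1 /\ t < d2.
  have : Num.min d1 d2 <= d1 by rewrite ge_min lexx.
  have : Num.min d1 d2 <= d2 by rewrite ge_min lexx orbT.
  by move: t0; rewrite /t => *; split; lra.
have := h1 t%:C; have := h2 t%:C; rewrite tm => /(_ td.2) k2 /(_ td.1) k1.
have : nrm (t%:C *: (l - m)) <= t * e.
  have -> : t%:C *: (l - m) = (g (z + t%:C) - g z - t%:C *: m) - (g (z + t%:C) - g z - t%:C *: l).
    by module_eq C.
  apply: le_trans (nrmB _ _) _; lra.
by rewrite nrmZ tm ler_pM2l.
Qed.

Lemma is_cd_cst c z : is_cd (fun=> c) z 0.
Proof.
move=> e e0; exists 1 => // h _.
by rewrite subrr scaler0 subrr nrm0 mulr_ge0 ?cabs_ge0 // ltW.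
Qed.

Lemma is_cdD g (h : C -> F) z l m : is_cd g z l -> is_cd h z m -> is_cd (fun w => g w + h w) z (l + m).
Proof.
move=> gl hm e e0; have e2 : 0 < e / 2 by lra.
have [d1 d10 h1] := gl _ e2; have [d2 d20 h2] := hm _ e2.
exists (Num.min d1 d2) => [|k]; rewrite lt_min ?d10 // => /andP[/h1 k1 /h2 k2].
have -> : g (z + k) + h (z + k) - (g z + h z) - k *: (l + m) =
  (g (z + k) - g z - k *: l) + (h (z + k) - h z - k *: m) by module_eq C.
apply: le_trans (nrmD _ _) _; lra.
Qed.

Lemma is_cdZ (a : C) g z l : is_cd g z l -> is_cd (fun w => a *: g w) z (a *: l).
Proof.
move=> gl e e0; have a0 : 0 < cabs a + 1 by have := cabs_ge0 a; lra.
have [d d0 h1] := gl _ (divr_gt0 e0 a0); exists d => // k /h1 k1.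
have -> : a *: g (z + k) - a *: g z - k *: (a *: l) = a *: (g (z + k) - g z - k *: l).
  by module_eq C.
rewrite nrmZ.
have : cabs a * (e / (cabs a + 1) * cabs k) <= e * cabs k.
  rewrite mulrA ler_wpM2r ?cabs_ge0 // mulrCA ler_piMr // ?(ltW e0) //.
  by rewrite ler_pdivrMr // mul1r lerDl.
apply: le_trans; by rewrite ler_wpM2l // cabs_ge0.
Qed.

Lemma is_cdN g z l : is_cd g z l -> is_cd (fun w => - g w) z (- l).
Proof.
move=> gl e e0; have [d d0 h1] := gl _ e0; exists d => // k /h1.
by congr (_ <= _); rewrite -nrmN; congr nrm; module_eq C.
Qed.

Lemma is_cdB g (h : C -> F) z l m : is_cd g z l -> is_cd h z m -> is_cd (fun w => g w - h w) z (l - m).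
Proof. by move=> gl /is_cdN; apply: is_cdD. Qed.

Lemma is_cd_lin l z : is_cd (fun w => w *: l) z l.
Proof.
move=> e e0; exists 1 => // h _.
have -> : (z + h) *: l - z *: l - h *: l = 0 by module_eq C.
by rewrite nrm0 mulr_ge0 ?cabs_ge0 // ltW.
Qed.

Lemma is_cd_shift g w z l : is_cd g (w + z) l <-> is_cd (fun x => g (w + x)) z l.
Proof.
by split=> gl e e0; have [d d0 h] := gl _ e0; exists d => // k /h; rewrite addrA.
Qed.

Lemma is_cd_near g (h : C -> F) z l r : 0 < r ->
  (forall w, cabs (w - z) < r -> g w = h w) -> is_cd g z l -> is_cd h z l.
Proof.
move=> r0 gh gl e e0; have [d d0 k] := gl _ e0.
exists (Num.min d r) => [|w]; rewrite lt_min ?d0 // => /andP[/k k1 wr].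
have <- : g (z + w) = h (z + w) by apply: gh; rewrite addrAC subrr add0r.
by have <- : g z = h z by apply: gh; rewrite subrr cabs0.
Qed.

(* A pair of points straddling the point of differentiability, with no
   continuity of the derivative needed. *)
Lemma mean_value_le g z h M : 0 <= M ->
  (forall t : R, 0 <= t <= 1 -> exists2 l, is_cd g (z + t%:C * h) l & nrm l <= M) ->
  nrm (g (z + h) - g z) <= M * cabs h.
Proof.
move=> M0 gcd; apply/ler_addgt0Pr => e e0; rewrite leNgt; apply/negP => lt.
(* A slack on the slope whose total over the segment is at most e; the 1 covers h = 0. *)
pose e' := e / (cabs h + 1).
have h0 := cabs_ge0 h.
have e'0 : 0 < e' by rewrite divr_gt0 //; lra.
have e'h : e' * cabs h <= e.
  by rewrite /e' mulrAC ler_pdivrMr ?ler_pM2l //; lra.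
pose x (s : R) := g (z + s%:C * h).
pose P (s t : R) k := (M + e') * cabs h * 2^-1 ^+ k < nrm (x (s + 2^-1 ^+ k) - x s).
have P0 : P 0 0 0%N.
  rewrite /P /x expr0 add0r mulr1 !(rmorph0, rmorph1) mul1r mul0r addr0.
  apply: le_lt_trans lt; lra.
have [s t k|s [t [s01 _ sP]]] := @bisection R P P0.
  (* The left half is kept if its increment is too large. Otherwise the right half is, since two
     good halves would make the whole good. The second coordinate of the bisection stays idle. *)
  rewrite /P => Pst; exists (~~ `[< P s t k.+1 >]), false.
  case: asboolP => /= [|/negP nP]; first by rewrite mul0r addr0.
  move: nP; rewrite -leNgt => nP; rewrite ltNge; apply/negP => le.
  move: Pst; rewrite ltNge => /negP; apply.
  have -> : s + 2^-1 ^+ k = s + 2^-1 ^+ k.+1 + 2^-1 ^+ k.+1 by rewrite exprS; field.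
  apply: le_trans (nrm_triB _ (x (s + 2^-1 ^+ k.+1)) _) _.
  move: le nP; rewrite mul1r => le nP; apply: le_trans (lerD le nP) _.
  by rewrite exprS; lra.
have [l cd lM] := gcd _ s01.
have [d d0 dP] := cd _ e'0.
have [k kP] := half_pow_lt (divr_gt0 d0 (ltr_wpDl h0 ltr01)).
have kd : 2^-1 ^+ k * cabs h < d.
  move: kP; rewrite ltr_pdivlMr; last by lra.
  apply: le_lt_trans; rewrite ler_wpM2l ?exprn_ge0 ?invr_ge0 //; lra.
have [s' [t' [Ps /andP[s1 s2] _]]] := sP k.
have near (r : R) : `|r - s| <= 2^-1 ^+ k ->
    nrm (x r - x s - ((r - s)%:C * h) *: l) <= e' * (`|r - s| * cabs h).
  move=> rs; have := dP ((r - s)%:C * h); rewrite cabsM cabs_real.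
  have -> : z + s%:C * h + (r - s)%:C * h = z + r%:C * h by rewrite rmorphB /=; ring.
  by apply; apply: le_lt_trans kd; rewrite ler_wpM2r.
have /near h1 : `|s' - s| <= 2^-1 ^+ k by rewrite ler_norml; apply/andP; split; lra.
have /near h2 : `|s' + 2^-1 ^+ k - s| <= 2^-1 ^+ k by rewrite ler_norml; apply/andP; split; lra.
move: Ps; rewrite /P ltNge => /negP; apply.
have -> : x (s' + 2^-1 ^+ k) - x s' =
   (x (s' + 2^-1 ^+ k) - x s - ((s' + 2^-1 ^+ k - s)%:C * h) *: l)
   - (x s' - x s - ((s' - s)%:C * h) *: l) + ((2^-1 ^+ k)%:C * h) *: l.
  by rewrite !rmorphB !rmorphD /=; module_eq C.
apply: le_trans (nrmD _ _) _; apply: le_trans (lerD (nrmB _ _) (lexx _)) _.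
rewrite nrmZ cabsM cabs_real ger0_norm ?exprn_ge0 ?invr_ge0 //.
have n1 : `|s' - s| = s - s' by rewrite ler0_norm ?opprB //; lra.
have n2 : `|s' + 2^-1 ^+ k - s| = s' + 2^-1 ^+ k - s by rewrite ger0_norm //; lra.
move: h1 h2; rewrite n1 n2.
set q := 2^-1 ^+ k; have q0 : 0 <= q by rewrite exprn_ge0 ?invr_ge0.
have : q * cabs h * nrm l <= q * cabs h * M by rewrite ler_wpM2l // mulr_ge0.
move=> *; lra.
Qed.
End ComplexDerivative.

(** * Goursat's lemma for dyadic path sums *)

Section PathSums.
Variables (R : realType) (F : normedModType R[i]).
Local Notation C := R[i].
Implicit Types (g : C -> F) (z w d e : C) (l m : F).

(** The left-endpoint Riemann sum, with 2^n equal pieces, for the integral of g along the segment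
    from z to z + d. Recursion by halving makes subdivision definitional. *)
Fixpoint psum g n z d : F :=
  if n is n'.+1 then psum g n' z (d / 2) + psum g n' (z + d / 2) (d / 2) else d *: g z.

Lemma psumB g (h : C -> F) n z d : psum (fun w => g w - h w) n z d = psum g n z d - psum h n z d.
Proof.
elim: n z d => [|n IH] z d /=; first by rewrite scalerBr.
by rewrite !IH; module_eq C.
Qed.

Lemma psum_periodic g e n z d : (forall w, g (w + e) = g w) -> psum g n (z + e) d = psum g n z d.
Proof.
by move=> ge; elim: n z d => [|n IH] z d /=; rewrite ?ge // addrAC !IH.
Qed.

Lemma psum_le K g n z d : (forall t : R, 0 <= t <= 1 -> nrm (g (z + t%:C * d)) <= K) ->
  nrm (psum g n z d) <= cabs d * K.
Proof.
elim: n z d => [|n IH] z d gK /=.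
  by rewrite nrmZ ler_wpM2l ?cabs_ge0 //; have := gK 0; rewrite rmorph0 mul0r addr0; apply; rewrite lexx ler01.
have -> : cabs d * K = cabs (d / 2) * K + cabs (d / 2) * K by rewrite cabs_half; field.
apply: le_trans (nrmD _ _) _; apply: lerD; apply: IH => t /andP[t0 t1].
  have -> : t%:C * (d / 2) = (t / 2)%:C * d by rewrite rmorphM fmorphV rmorph_nat /=; field.
  apply: gK; apply/andP; split; lra.
have -> : z + d / 2 + t%:C * (d / 2) = z + ((1 + t) / 2)%:C * d.
  by rewrite rmorphM fmorphV rmorph_nat rmorphD rmorph1 /=; field.
apply: gK; apply/andP; split; lra.
Qed.

(** The sum misses the integral by d^2/2 2^-n l, a defect that does not depend on z. It therefore
    cancels between opposite sides of a parallelogram, where affine functions have sum exactly zero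
    at every level. *)
Lemma psum_affine (c l : F) p n z d :
  psum (fun w => c + (w - p) *: l) n z d =
  d *: c + (d * (z - p) + d ^+ 2 / 2 * (1 - 2^-1 ^+ n)) *: l.
Proof.
elim: n z d => [|n IH] z d /=; first by rewrite expr0; module_eq C.
by rewrite !IH (exprS 2^-1 n); module_eq C.
Qed.

Lemma psum_cst (c : F) n z d : psum (fun=> c) n z d = d *: c.
Proof.
have := psum_affine c 0 0 n z d; rewrite scaler0 addr0 => <-.
by congr psum; apply: funext => w; rewrite scaler0 addr0.
Qed.

(** The contour sum around z, z + d, z + d + e, z + e. The two returning sides are sampled in the
    direction of their opposites and subtracted, so that errors on opposite sides match. *)
Definition parallelogram_sum g n z d e :=
  psum g n z d + psum g n (z + d) e - psum g n (z + e) d - psum g n z e.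

Lemma parallelogram_sumS g n z d e :
  parallelogram_sum g n.+1 z d e =
    parallelogram_sum g n z (d / 2) (e / 2) + parallelogram_sum g n (z + d / 2) (d / 2) (e / 2)
  + parallelogram_sum g n (z + e / 2) (d / 2) (e / 2)
  + parallelogram_sum g n (z + d / 2 + e / 2) (d / 2) (e / 2).
Proof.
rewrite /parallelogram_sum /=.
have -> : z + d / 2 + d / 2 = z + d by field.
have -> : z + e / 2 + e / 2 = z + e by field.
have -> : z + e / 2 + d / 2 = z + d / 2 + e / 2 by ring.
have -> : z + d / 2 + e / 2 + d / 2 = z + d + e / 2 by field.
have -> : z + d / 2 + e / 2 + e / 2 = z + e + d / 2 by field.
by module_eq C.
Qed.

Lemma parallelogram_sum_affine (c l : F) p n z d e :
  parallelogram_sum (fun w => c + (w - p) *: l) n z d e = 0.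
Proof. by rewrite /parallelogram_sum !psum_affine; module_eq C. Qed.

Lemma parallelogram_sumB g (h : C -> F) n z d e :
  parallelogram_sum (fun w => g w - h w) n z d e =
  parallelogram_sum g n z d e - parallelogram_sum h n z d e.
Proof. by rewrite /parallelogram_sum !psumB; module_eq C. Qed.

Lemma parallelogram_sum_le K g n z d e :
  (forall s t : R, 0 <= s <= 1 -> 0 <= t <= 1 -> nrm (g (z + s%:C * d + t%:C * e)) <= K) ->
  nrm (parallelogram_sum g n z d e) <= 2 * (cabs d + cabs e) * K.
Proof.
move=> gK; have I0 : (0 : R) <= (0 : R) <= (1 : R) by rewrite lexx ler01.
have I1 : (0 : R) <= (1 : R) <= (1 : R) by rewrite lexx ler01.
have h1 : nrm (psum g n z d) <= cabs d * K.
  by apply: psum_le => t t01; have := gK t 0 t01 I0; rewrite rmorph0 mul0r addr0.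
have h2 : nrm (psum g n (z + d) e) <= cabs e * K.
  by apply: psum_le => t t01; have := gK 1 t I1 t01; rewrite rmorph1 mul1r.
have h3 : nrm (psum g n (z + e) d) <= cabs d * K.
  by apply: psum_le => t t01; have := gK t 1 t01 I1; rewrite rmorph1 mul1r addrAC.
have h4 : nrm (psum g n z e) <= cabs e * K.
  by apply: psum_le => t t01; have := gK 0 t I0 t01; rewrite rmorph0 mul0r addr0.
rewrite /parallelogram_sum.
apply: le_trans (nrmB _ _) _; apply: le_trans (lerD (nrmB _ _) (lexx _)) _.
apply: le_trans (lerD (lerD (nrmD _ _) (lexx _)) (lexx _)) _; lra.
Qed.

(* Goursat's bisection. The path sums refine dyadically, so the sum of level
   n+1 over a parallelogram is exactly the sum of level n over its quarters,
   and no integral is needed. *)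
Lemma goursat g z d e :
  (forall s t : R, 0 <= s <= 1 -> 0 <= t <= 1 -> exists l, is_cd g (z + s%:C * d + t%:C * e) l) ->
  forall eps : R, 0 < eps -> exists N, forall n, (N <= n)%N ->
    nrm (parallelogram_sum g n z d e) <= eps.
Proof.
move=> gcd eps eps0.
(* A parallelogram of generation k is allowed the share 4^-k of eps; if all four quarters keep to
   their share, so does their parent. *)
pose small k w := exists N, forall n, (N <= n)%N ->
  nrm (parallelogram_sum g n w ((2^-1 ^+ k)%:C * d) ((2^-1 ^+ k)%:C * e)) <= eps * 4^-1 ^+ k.
pose P (s t : R) k := ~ small k (z + s%:C * d + t%:C * e).
have [[N NP]|P0] := pselect (small 0%N z).
  by exists N => n /NP; rewrite !expr0 !rmorph1 !mul1r mulr1.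
have P0' : P 0 0 0%N by rewrite /P rmorph0 !mul0r !addr0.
have [s t k Pst|s [t [s01 t01 stP]]] := @bisection R P P0'.
  apply: contrapT => nex; apply: Pst.
  have all (a b : bool) : small k.+1
     (z + (s + a%:R * 2^-1 ^+ k.+1)%:C * d + (t + b%:R * 2^-1 ^+ k.+1)%:C * e).
    by apply: contrapT => h; apply: nex; exists a, b.
  have [n0 h0] := all false false; have [n1 h1] := all true false.
  have [n2 h2] := all false true; have [n3 h3] := all true true.
  (* The successor pays for the level lost when passing to the quarters. *)
  exists (maxn (maxn n0 n1) (maxn n2 n3)).+1 => -[//|n]; rewrite ltnS !geq_max.
  move=> /andP[/andP[/h0 k0 /h1 k1] /andP[/h2 k2 /h3 k3]].
  rewrite parallelogram_sumS.
  move: k0 k1 k2 k3; rewrite !mul0r !addr0 !mul1r.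
  have hd (c : C) : (2^-1 ^+ k)%:C * c / 2 = (2^-1 ^+ k.+1)%:C * c.
    by rewrite exprS rmorphM fmorphV rmorph_nat /=; field.
  have ad (x : R) (c : C) : (x + 2^-1 ^+ k.+1)%:C * c = x%:C * c + (2^-1 ^+ k.+1)%:C * c.
    by rewrite rmorphD mulrDl.
  rewrite !hd !ad.
  have -> : z + (s%:C * d + (2^-1 ^+ k.+1)%:C * d) + t%:C * e =
            z + s%:C * d + t%:C * e + (2^-1 ^+ k.+1)%:C * d by ring.
  have -> : z + s%:C * d + (t%:C * e + (2^-1 ^+ k.+1)%:C * e) =
            z + s%:C * d + t%:C * e + (2^-1 ^+ k.+1)%:C * e by ring.
  have -> : z + (s%:C * d + (2^-1 ^+ k.+1)%:C * d) + (t%:C * e + (2^-1 ^+ k.+1)%:C * e) =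
            z + s%:C * d + t%:C * e + (2^-1 ^+ k.+1)%:C * d + (2^-1 ^+ k.+1)%:C * e by ring.
  move=> k0 k1 k2 k3.
  apply: le_trans (nrmD _ _) _; apply: le_trans (lerD (nrmD _ _) (lexx _)) _.
  apply: le_trans (lerD (lerD (nrmD _ _) (lexx _)) (lexx _)) _.
  apply: le_trans (lerD (lerD (lerD k0 k1) k2) k3) _.
  by rewrite (exprS 4^-1); lra.
have [l cd] := gcd _ _ s01 t01; set p := z + s%:C * d + t%:C * e in cd.
set L := cabs d + cabs e.
have d_ge0 := cabs_ge0 d; have e_ge0 := cabs_ge0 e.
have L0 : 0 <= L by rewrite addr_ge0.
(* At scale q the perimeter is 2 q L and the error off the tangent map at most eps' q L, so 2 L^2
   eps' has to stay below eps. *)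
pose eps' := eps / (2 * L ^+ 2 + 1).
have L2 : 0 < 2 * L ^+ 2 + 1 by have := sqr_ge0 L; lra.
have eps'0 : 0 < eps' by rewrite divr_gt0.
have [r r0 rP] := cd _ eps'0.
have [k kP] := half_pow_lt (divr_gt0 r0 (ltr_wpDl L0 ltr01)).
set q := (2^-1 : R) ^+ k in kP.
have q0 : 0 <= q by rewrite exprn_ge0 ?invr_ge0.
have qL : q * L < r.
  move: kP; rewrite ltr_pdivlMr; last by lra.
  apply: le_lt_trans; rewrite ler_wpM2l //; lra.
have [s' [t' [Pst /andP[s1 s2] /andP[t1 t2]]]] := stP k.
(* Close to the point of differentiability, subtracting the tangent affine map leaves the sum
   unchanged and makes it small at every level. *)
case: Pst; exists 0%N => n _.
pose aff w := g p + (w - p) *: l.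
have -> (w d' e' : C) : parallelogram_sum g n w d' e' =
   parallelogram_sum (fun w => g w - aff w) n w d' e'.
  by rewrite parallelogram_sumB parallelogram_sum_affine subr0.
apply: le_trans (parallelogram_sum_le (K := eps' * (q * L)) _ _) _.
  move=> x y /andP[x0 x1] /andP[y0 y1].
  set w := _ + y%:C * _.
  have wp : w - p = (s' + x * q - s)%:C * d + (t' + y * q - t)%:C * e.
    by rewrite /w /p /q !rmorphB !rmorphD !rmorphM /=; ring.
  have wL : cabs (w - p) <= q * L.
    rewrite wp; apply: le_trans (cabsD _ _) _; rewrite !cabsM !cabs_real /L mulrDr.
    have xq : 0 <= x * q <= q by rewrite mulr_ge0 //= ler_piMl.
    have yq : 0 <= y * q <= q by rewrite mulr_ge0 //= ler_piMl.
    move: s2 t2; rewrite -/q => s2 t2.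
    apply: lerD; rewrite ler_wpM2r // ler_norml; lra.
  have := rP (w - p) (le_lt_trans wL qL); rewrite (_ : p + (w - p) = w); last by ring.
  have -> : g w - aff w = g w - g p - (w - p) *: l by rewrite /aff; module_eq C.
  move=> h; apply: le_trans h _.
  by rewrite ler_wpM2l // ltW.
rewrite -/q !cabsM !cabs_real !(ger0_norm q0) -mulrDr -/L.
have -> : 4^-1 ^+ k = q ^+ 2 :> R by rewrite /q -exprM mulnC exprM; congr (_ ^+ _); field.
have -> : 2 * (q * L) * (eps' * (q * L)) = (2 * L ^+ 2 * eps') * q ^+ 2 by ring.
rewrite ler_wpM2r ?sqr_ge0 // /eps' mulrA ler_pdivrMr //.
by rewrite mulrC ler_wpM2l ?(ltW eps0) //; lra.
Qed.
End PathSums.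

(** * The Cauchy estimate *)

Section Calculus.
Variables (R : realType) (F : normedModType R[i]).
Local Notation C := R[i].
Implicit Types (g : C -> F) (phi : C -> C^o) (z w h a : C) (l m : F).

Lemma nrm_scalar (a : C) : nrm (a : C^o) = cabs a.
Proof. by rewrite /nrm [X in complex.Re X](cabsE a). Qed.

Lemma is_cd_inv z : z != 0 -> is_cd (fun w => w^-1 : C^o) z (- (z ^- 2)).
Proof.
move=> z0 e e0; have az := cabs_gt0 z0.
(* The remainder is h^2 / (z^2 (z + h)); the first radius gives |z + h| >= |z| / 2, the second turns
   the resulting bound into e |h|. *)
pose d := Num.min (cabs z / 2) (e * cabs z ^+ 3 / 2).
exists d => [|h]; rewrite lt_min.
  by apply/andP; split; rewrite divr_gt0 // mulr_gt0 ?exprn_gt0.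
move=> /andP[h1 h2].
have zh : cabs z / 2 <= cabs (z + h).
  have := cabsD (z + h) (- h); rewrite cabsN addrK; lra.
have zh0 : z + h != 0.
  by apply/eqP => E; move: zh; rewrite E cabs0; lra.
rewrite nrm_scalar.
have -> : (z + h)^-1 - z^-1 - h *: (- z ^- 2 : C^o) = h * (h * (z ^- 2 * (z + h)^-1)) :> C.
  rewrite /GRing.scale /=; field.
  by rewrite zh0 z0.
rewrite cabsM mulrC ler_wpM2r ?cabs_ge0 // !cabsM !cabsV expr2 cabsM.
have p1 : 0 < cabs z * cabs z * cabs (z + h) by rewrite !mulr_gt0 // ?cabs_gt0.
rewrite mulrA -mulrA -invfM ler_pdivrMr //.
have : e * (cabs z * cabs z * (cabs z / 2)) <= e * (cabs z * cabs z * cabs (z + h)).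
  by rewrite !ler_wpM2l ?mulr_ge0 // ltW.
rewrite !exprS expr0 in h2; lra.
Qed.

Lemma is_cd_scale phi g z a l : is_cd phi z a -> is_cd g z l ->
  is_cd (fun w => (phi w : C) *: g w) z ((phi z : C) *: l + a *: g z).
Proof.
move=> phia gl e e0.
(* [B] collects the coefficients of e1 |h| in the three error terms bounded at the end. *)
pose B := cabs (phi z) + cabs a * (nrm l + 1) + nrm (g z) + nrm l + 1.
have [c0 a0 n0 l0] : [/\ 0 <= cabs (phi z), 0 <= cabs a, 0 <= nrm (g z) & 0 <= nrm l].
  by rewrite !cabs_ge0 !nrm_ge0.
have al0 : 0 <= cabs a * (nrm l + 1) by rewrite mulr_ge0 // addr_ge0.
have B0 : 0 < B by rewrite /B; lra.
pose e1 := Num.min 1 (e / B).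
have e10 : 0 < e1 by rewrite lt_min ltr01 divr_gt0.
have e11 : e1 <= 1 by rewrite ge_min lexx.
have e1B : e1 * B <= e.
  by rewrite -ler_pdivlMr // ge_min lexx orbT.
clearbody e1.
have [d1 d10 P1] := phia _ e10; have [d2 d20 P2] := gl _ e10.
exists (Num.min e1 (Num.min d1 d2)) => [|h]; rewrite !lt_min ?e10 ?d10 //.
move=> /andP[he /andP[/P1 h1 /P2 h2]].
set q := phi (z + h) - phi z - h *: a in h1; rewrite nrm_scalar in h1.
set r := g (z + h) - g z - h *: l in h2.
have h0 := cabs_ge0 h.
have gzh : nrm (g (z + h)) <= nrm (g z) + nrm l + 1.
  have -> : g (z + h) = g z + h *: l + r by rewrite /r; module_eq C.
  apply: le_trans (nrmD _ _) _; apply: le_trans (lerD (nrmD _ _) (lexx _)) _.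
  rewrite nrmZ -addrA -addrA lerD2l.
  have : cabs h * nrm l + e1 * cabs h <= e1 * nrm l + 1.
     apply: lerD; first by rewrite ler_wpM2r // ltW.
     by rewrite mulr_ile1 // ltW // (lt_le_trans he).
  have : e1 * nrm l <= nrm l by rewrite ler_piMl.
  lra.
have -> : (phi (z + h) : C) *: g (z + h) - (phi z : C) *: g z - h *: ((phi z : C) *: l + a *: g z)
  = (phi z : C) *: r + (h * a) *: (h *: l + r) + (q : C) *: g (z + h).
  have -> : q = phi (z + h) - phi z - h * a :> C by [].
  by rewrite /r; module_eq C.
apply: le_trans (nrmD _ _) _; apply: le_trans (lerD (nrmD _ _) (lexx _)) _.
rewrite !nrmZ cabsM.
have k1 : cabs (phi z) * nrm r <= cabs (phi z) * (e1 * cabs h) by rewrite ler_wpM2l.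
have k2 : cabs h * cabs a * nrm (h *: l + r) <= cabs h * cabs a * (e1 * (nrm l + 1)).
  rewrite ler_wpM2l ?mulr_ge0 //; apply: le_trans (nrmD _ _) _.
  rewrite nrmZ mulrDr mulr1; apply: lerD; first by rewrite ler_wpM2r // ltW.
  by apply: le_trans h2 _; rewrite ler_piMr ?(ltW e10) // ltW // (lt_le_trans he).
have k3 : cabs q * nrm (g (z + h)) <= e1 * cabs h * (nrm (g z) + nrm l + 1).
  by rewrite ler_pM ?cabs_ge0 ?nrm_ge0.
apply: le_trans (lerD (lerD k1 k2) k3) _.
have := ler_wpM2r h0 e1B; rewrite /B; lra.
Qed.

Lemma is_cd_comp phi g z a l : is_cd phi z a -> is_cd g (phi z) l ->
  is_cd (fun w => g (phi w)) z (a *: l).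
Proof.
move=> phia gl e e0.
have [a0 l0] : 0 <= cabs a /\ 0 <= nrm l by rewrite cabs_ge0 nrm_ge0.
have e10 : 0 < e / 2 / (cabs a + 1) by rewrite !divr_gt0 //; lra.
pose e2 := Num.min 1 (e / 2 / (nrm l + 1)).
have e20 : 0 < e2 by rewrite lt_min ltr01 !divr_gt0 //; lra.
have e21 : e2 <= 1 by rewrite ge_min lexx.
have e2l : e2 * (nrm l + 1) <= e / 2 by rewrite -ler_pdivlMr ?ge_min ?lexx ?orbT //; lra.
clearbody e2.
have [d1 d10 P1] := gl _ e10; have [d2 d20 P2] := phia _ e20.
have d1a : 0 < d1 / (cabs a + 1) by rewrite divr_gt0 //; lra.
exists (Num.min (d1 / (cabs a + 1)) d2) => [|h]; rewrite lt_min ?d1a //.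
rewrite ltr_pdivlMr; last lra.
move=> /andP[hd /P2]; rewrite nrm_scalar; set q : C := _ - _ - _ => hq.
have h0 := cabs_ge0 h.
pose k : C := phi (z + h) - phi z.
have kq : k = h * a + q by rewrite /k /q /GRing.scale /=; ring.
have ka : cabs k <= cabs h * (cabs a + 1).
  rewrite kq; apply: le_trans (cabsD _ _) _; rewrite cabsM mulrDr mulr1 lerD2l.
  by apply: le_trans hq _; rewrite ler_piMl.
have := P1 k (le_lt_trans ka hd); rewrite (_ : phi z + k = phi (z + h)); last by rewrite /k; ring.
move=> hk.
have -> : g (phi (z + h)) - g (phi z) - h *: (a *: l) =
  (g (phi (z + h)) - g (phi z) - k *: l) + q *: l by rewrite kq; module_eq C.
apply: le_trans (nrmD _ _) _; rewrite nrmZ.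
have k1 : e / 2 / (cabs a + 1) * cabs k <= e / 2 * cabs h.
  rewrite mulrAC ler_pdivrMr ?ltr_wpDl // -[leRHS]mulrA ler_wpM2l //; lra.
have k2 : cabs q * nrm l <= e2 * cabs h * nrm l by rewrite ler_wpM2r.
have := ler_wpM2r h0 e2l.
have : 0 <= e2 * cabs h by rewrite mulr_ge0 // ltW.
lra.
Qed.
End Calculus.

(** * The complex exponential and its derivative *)

Section Exponential.
Variable R : realType.
Local Notation C := R[i].

Definition cexp (z : C) : C^o :=
  (expR (complex.Re z) * cos (complex.Im z)) +i* (expR (complex.Re z) * sin (complex.Im z)).

Lemma cexpD (z w : C) : cexp (z + w) = (cexp z : C) * cexp w.
Proof.
case: z w => [a b] [c d]; rewrite /cexp /= expRD cosD sinD.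
apply/eqP; rewrite eq_complex /=; apply/andP; split; apply/eqP; ring.
Qed.

Lemma cabs_cexp z : cabs (cexp z) = expR (complex.Re z).
Proof.
by rewrite /cabs /= !exprMn -mulrDr cos2Dsin2 mulr1 sqrtr_sqr ger0_norm // expR_ge0.
Qed.

Lemma cexp0 : cexp 0 = 1.
Proof. by rewrite /cexp /= expR0 cos0 sin0 mulr0 mulr1. Qed.

Lemma cexp_neq0 z : (cexp z : C) != 0.
Proof.
apply/eqP => /(congr1 (@cabs R)); rewrite cabs_cexp cabs0 => /eqP.
by rewrite gt_eqF ?expR_gt0.
Qed.

Lemma cexp_2pi (z : C) : cexp (z + 0 +i* (pi *+ 2)) = cexp z.
Proof.
by rewrite cexpD [X in _ * X]/cexp /= expR0 cos2pi sin2pi mulr0 mulr1 mulr1.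
Qed.

Lemma is_derive_eps (f : R -> R) (x df : R) : is_derive x (1 : R) f df ->
  forall e : R, 0 < e -> exists2 d : R, 0 < d &
  forall h, `|h| < d -> `|f (x + h) - f x - h * df| <= e * `|h|.
Proof.
move=> [dfx Dfx] e e0.
have : h^-1 *: ((f \o shift x) (h *: 1) - f x) @[h --> 0^'] --> df by rewrite -Dfx.
move=> /cvgrPdist_le/(_ _ e0)/nbhs_ballP[d d0 dP]; exists d => // h hd.
have [->|h0] := eqVneq h 0; first by rewrite addr0 mul0r subrr subr0 normr0 mulr0.
have := dP h; rewrite /ball /= sub0r normrN => /(_ hd h0).
rewrite -[h *: 1]/(h * 1) mulr1 /shift (addrC h x) => H.
have -> : f (x + h) - f x - h * df = - (h * (df - h^-1 * (f (x + h) - f x))) by field.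
by rewrite normrN normrM mulrC ler_wpM2r.
Qed.

(** The derivative at 0 comes from the first order expansions of the real exponential, cosine and
    sine; the functional equation carries it to every z. *)
Lemma is_cd_cexp z : is_cd cexp z (cexp z).
Proof.
have is_cd0 : is_cd cexp 0 1.
  move=> e e0.
  (* Nine error terms of size at most e' |h| arise, four in the real part and five in the imaginary
     part. *)
  pose e' := Num.min 1 (e / 16).
  have e'0 : 0 < e' by rewrite lt_min ltr01 divr_gt0.
  have e'1 : e' <= 1 by rewrite ge_min lexx.
  have e'e : e' <= e / 16 by rewrite ge_min lexx orbT.
  clearbody e'.
  have [d1 d10 P1] := is_derive_eps (is_derive_expR 0) e'0.
  have [d2 d20 P2] := is_derive_eps (is_derive_cos 0) e'0.
  have [d3 d30 P3] := is_derive_eps (is_derive_sin 0) e'0.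
  exists (Num.min (Num.min e' d1) (Num.min d2 d3)) => [|h].
    by rewrite !lt_min e'0 d10 d20 d30.
  rewrite !lt_min => /andP[/andP[he h1] /andP[h2 h3]].
  rewrite nrm_scalar add0r cexp0.
  case: h he h1 h2 h3 => x y he h1 h2 h3.
  set n := cabs _ in he h1 h2 h3 *.
  have xn : `|x| <= n by rewrite -sqrtr_sqr ler_sqrt ?lerDl ?sqr_ge0 // addr_ge0 ?sqr_ge0.
  have yn : `|y| <= n by rewrite -sqrtr_sqr ler_sqrt ?lerDr ?sqr_ge0 // addr_ge0 ?sqr_ge0.
  have n0 : 0 <= n := cabs_ge0 _.
  have := P1 x (le_lt_trans xn h1); have := P2 y (le_lt_trans yn h2).
  have := P3 y (le_lt_trans yn h3).
  rewrite !add0r expR0 cos0 sin0 oppr0 mulr0 !mulr1 !subr0 ?addr0 => c' b' a'.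
  have ex : cexp (x +i* y) - 1 - (x +i* y) *: (1 : C^o) =
    (expR x * cos y - 1 - x)%:C + (expR x * sin y - y)%:C * 'i :> C.
    apply/eqP; rewrite eq_complex /=; apply/andP; split; apply/eqP; ring.
  rewrite ex; apply: le_trans (cabsD _ _) _; rewrite cabsM !cabs_real.
  have -> : cabs ('i : C) = 1 by rewrite /cabs /= expr0n add0r expr1n sqrtr1.
  rewrite mulr1.
  set a := expR x - 1 - x in a'; set b := cos y - 1 in b'; set c := sin y - y in c'.
  have E1 : expR x = 1 + x + a by rewrite /a; ring.
  have E2 : cos y = 1 + b by rewrite /b; ring.
  have E3 : sin y = y + c by rewrite /c; ring.
  have a1 : `|a| <= e' * n by apply: le_trans a' _; rewrite ler_wpM2l // ltW.
  have b1 : `|b| <= e' * n by apply: le_trans b' _; rewrite ler_wpM2l // ltW.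
  have c1 : `|c| <= e' * n by apply: le_trans c' _; rewrite ler_wpM2l // ltW.
  have n1 : n <= 1 by apply: le_trans (ltW he) e'1.
  have en1 : e' * n <= 1 by rewrite mulr_ile1 // ltW.
  have small (u v : R) : `|u| <= 1 -> `|v| <= e' * n -> `|u * v| <= e' * n.
    by move=> u1 v1; rewrite normrM; apply: le_trans v1; rewrite ler_piMl.
  have x1 : `|x| <= 1 by lra.
  have a2 : `|a| <= 1 by lra.
  have xy : `|x * y| <= e' * n.
    by rewrite normrM ler_pM // (le_trans xn) // ltW.
  have xb := small _ _ x1 b1; have ab := small _ _ a2 b1.
  have xc := small _ _ x1 c1; have ac := small _ _ a2 c1.
  have ay : `|a * y| <= e' * n by rewrite mulrC; apply: small => //; lra.
  have t1 : `|expR x * cos y - 1 - x| <= 4 * (e' * n).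
    have -> : expR x * cos y - 1 - x = b + x * b + a + a * b by rewrite E1 E2; ring.
    apply: le_trans (ler_normD _ _) _; apply: le_trans (lerD (ler_normD _ _) (lexx _)) _.
    apply: le_trans (lerD (lerD (ler_normD _ _) (lexx _)) (lexx _)) _; lra.
  have t2 : `|expR x * sin y - y| <= 5 * (e' * n).
    have -> : expR x * sin y - y = c + x * y + x * c + a * y + a * c by rewrite E1 E3; ring.
    apply: le_trans (ler_normD _ _) _; apply: le_trans (lerD (ler_normD _ _) (lexx _)) _.
    apply: le_trans (lerD (lerD (ler_normD _ _) (lexx _)) (lexx _)) _.
    apply: le_trans (lerD (lerD (lerD (ler_normD _ _) (lexx _)) (lexx _)) (lexx _)) _; lra.
  have := ler_wpM2r n0 e'e; have := mulr_ge0 (ltW e0) n0; lra.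
have := is_cdZ (cexp z) is_cd0.
have -> : (fun w => (cexp z : C) *: cexp w) = (fun w => cexp (z + w)).
  by apply: funext => w; rewrite cexpD.
rewrite -is_cd_shift addr0; congr is_cd.
exact: mulr1.
Qed.
End Exponential.

Section CauchyEstimate.
Variables (R : realType) (F : normedModType R[i]).
Local Notation C := R[i].

(* The function (g(z) - g(0)) / z pulled back by the exponential is
   2 i pi-periodic, so by Goursat its mean over a vertical segment of length
   2 pi does not depend on the abscissa x; it tends to g'(0) as x tends to
   -oo. *)
Lemma cauchy_estimate (g : C -> F) r K l : 0 < r ->
  (forall z, cabs z <= r -> exists l, is_cd g z l) ->
  (forall z, cabs z <= r -> nrm (g z) <= K) ->
  is_cd g 0 l -> nrm l <= 2 * K / r.
Proof.
move=> r0 gcd gK gl; apply/ler_addgt0Pr => eps eps0.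
pose b := ln r; have br : expR b = r by rewrite lnK // posrE.
have e20 : 0 < eps / 2 by lra.
have [d d0 dP] := gl _ e20.
(* The exponential maps the line of abscissa b to the circle of radius r, and that of abscissa a to
   a circle so small that the difference quotient is within eps / 2 of l. *)
pose a := Num.min b (ln (d / 2)).
have ab : a <= b by rewrite ge_min lexx.
have ad : expR a < d.
  have : expR a <= d / 2 by rewrite -(lnK (x := d / 2)) ?posrE ?divr_gt0 // ler_expR ge_min lexx orbT.
  lra.
pose k w := w^-1 *: (g w - g 0).
pose h z := k (cexp z).
pose per : C := 0 +i* (pi *+ 2); pose dx : C := (b - a)%:C.
have hper w : h (w + per) = h w by rewrite /h cexp_2pi.
have pi0 : 0 < pi *+ 2 :> R by rewrite mulrn_wgt0 // pi_gt0.
have cper : cabs per = pi *+ 2.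
  by rewrite /cabs /= expr0n /= add0r sqrtr_sqr gtr0_norm.
have hcd (s t : R) : 0 <= s <= 1 -> 0 <= t <= 1 ->
    exists m, is_cd h (a%:C + s%:C * dx + t%:C * per) m.
  move=> /andP[s0 s1] _; set w := _ + t%:C * per.
  have wr : cabs (cexp w) <= r.
    rewrite cabs_cexp -br ler_expR /= !(mul0r, mulr0, subr0, addr0).
    have := ler_wpM2r (_ : 0 <= b - a) s1; rewrite subr_ge0 => /(_ ab); lra.
  have [m mP] := gcd _ wr.
  have cdk := is_cd_scale (is_cd_inv (cexp_neq0 w)) (is_cdB mP (is_cd_cst (g 0) _)).
  by have := is_cd_comp (is_cd_cexp w) cdk; eexists; eassumption.
have [N /(_ N (leqnn N))] := goursat hcd (mulr_gt0 pi0 e20).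
(* By periodicity the two horizontal sides cancel, and only the two vertical ones remain. *)
rewrite /parallelogram_sum (psum_periodic _ _ _ hper).
have -> (u v w : F) : u + v - u - w = v - w by module_eq C.
have ad_b : a%:C + dx = b%:C by rewrite /dx -rmorphD; congr _%:C; ring.
rewrite ad_b.
have sb : nrm (psum h N b%:C per) <= cabs per * (2 * K / r).
  apply: psum_le => t _; rewrite /h /k nrmZ cabsV cabs_cexp /=.
  rewrite !(mul0r, mulr0, subr0, addr0) br mulrC ler_wpM2r ?invr_ge0 ?(ltW r0) //.
  apply: le_trans (nrmB _ _) _.
  have g1 : nrm (g (cexp (b%:C + t%:C * per))) <= K.
    by apply: gK; rewrite cabs_cexp /= !(mul0r, mulr0, subr0, addr0) br.
  have g0 : nrm (g 0) <= K by apply: gK; rewrite cabs0 ltW.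
  lra.
have sa : nrm (psum h N a%:C per - per *: l) <= cabs per * (eps / 2).
  rewrite -(psum_cst l N a%:C per) -psumB; apply: psum_le => t _.
  rewrite -[leLHS]/(nrm (h (a%:C + t%:C * per) - l)).
  pose w := cexp (a%:C + t%:C * per).
  have wa : cabs w = expR a by rewrite cabs_cexp /= !(mul0r, mulr0, subr0, addr0).
  have w0 : (w : C) != 0 := cexp_neq0 _.
  have := dP w; rewrite wa add0r => /(_ ad) H.
  have -> : h (a%:C + t%:C * per) - l = (w : C)^-1 *: (g w - g 0 - (w : C) *: l).
    rewrite /h /k -/w; module_eq C.
  rewrite nrmZ cabsV wa mulrC ler_pdivrMr ?expR_gt0 //.
rewrite cper in sa sb *; move=> sab.
have : cabs per * nrm l <= cabs per * (2 * K / r + eps).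
  rewrite -nrmZ cper.
  have -> : per *: l = psum h N b%:C per - (psum h N b%:C per - psum h N a%:C per)
     - (psum h N a%:C per - per *: l) by module_eq C.
  apply: le_trans (nrmB _ _) _; apply: le_trans (lerD (nrmB _ _) (lexx _)) _.
  lra.
by rewrite cper ler_pM2l.
Qed.
End CauchyEstimate.

(** * Taylor expansion of bounded holomorphic functions on a disc *)

Section BoundedHolomorphic.
Variables (R : realType) (F : normedModType R[i]).
Local Notation C := R[i].
Implicit Types (g : C -> F) (z w : C) (s r K : R).

Definition bholo s K g :=
  (forall z, cabs z < s -> exists l, is_cd g z l) /\
  (forall z, cabs z < s -> nrm (g z) <= K).

(** The value is 0 where no derivative exists. *)
Definition cderiv g z : F := xget 0 [set l | is_cd g z l].

Lemma cderivP g z : (exists l, is_cd g z l) -> is_cd g z (cderiv g z).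
Proof. by move=> [l h]; apply: (xgetPex 0 (ex_intro _ l h)). Qed.

Lemma cderivE g z l : is_cd g z l -> cderiv g z = l.
Proof. by move=> h; apply: (is_cd_unique (cderivP _) h); exists l. Qed.

Lemma cderiv_shift g w z : cderiv (fun x => g (w + x)) z = cderiv g (w + z).
Proof.
by congr xget; apply/seteqP; split => l /=; case: (is_cd_shift g w z l).
Qed.

Lemma bholo_ge0 s K g : 0 < s -> bholo s K g -> 0 <= K.
Proof.
by move=> s0 [_ /(_ 0)]; rewrite cabs0 => /(_ s0); apply: le_trans (nrm_ge0 _).
Qed.

Lemma bholo_shift s r K g w : cabs w + r <= s -> bholo s K g -> bholo r K (fun z => g (w + z)).
Proof.
move=> rs [gcd gK]; have le z : cabs z < r -> cabs (w + z) < s.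
  by move=> zr; apply: le_lt_trans (cabsD _ _) _; lra.
split=> z /le zs; last exact: gK.
by have [l] := gcd _ zs; rewrite is_cd_shift => h; exists l.
Qed.

Lemma bholoD s K L g (h : C -> F) : bholo s K g -> bholo s L h -> bholo s (K + L) (fun z => g z + h z).
Proof.
move=> [gcd gK] [hcd hL]; split=> z zs.
  by have [l lP] := gcd _ zs; have [m mP] := hcd _ zs; exists (l + m); apply: is_cdD.
by apply: le_trans (nrmD _ _) (lerD (gK _ zs) (hL _ zs)).
Qed.

Lemma bholoZ s K g (a : C) : bholo s K g -> bholo s (cabs a * K) (fun z => a *: g z).
Proof.
move=> [gcd gK]; split=> z zs.
  by have [l lP] := gcd _ zs; exists (a *: l); apply: is_cdZ.
by rewrite nrmZ ler_wpM2l ?cabs_ge0 // gK.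
Qed.

Lemma cderiv_le s r K g z : 0 < r -> cabs z + r < s -> bholo s K g -> nrm (cderiv g z) <= 2 * K / r.
Proof.
move=> r0 zr hg; pose t := s - cabs z.
have [gcd gK] : bholo t K (fun x => g (z + x)).
  by apply: bholo_shift hg; rewrite /t; lra.
rewrite -[z in cderiv g z]addr0 -cderiv_shift.
have rt x : cabs x <= r -> cabs x < t by rewrite /t => ?; lra.
apply: (cauchy_estimate (g := fun x => g (z + x))) => //.
- by move=> x /rt; apply: gcd.
- by move=> x /rt; apply: gK.
by apply: cderivP; apply: gcd; rewrite cabs0 /t; have := cabs_ge0 z; lra.
Qed.

Lemma cabs_conv_lt z h (t s : R) : 0 <= t <= 1 -> cabs z + cabs h < s -> cabs (z + t%:C * h) < s.
Proof.
move=> /andP[t0 t1]; apply: le_lt_trans; apply: le_trans (cabsD _ _) _.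
by rewrite lerD2l cabsM cabs_real ger0_norm // ler_piMl ?cabs_ge0.
Qed.

Lemma bholo_lip s r K g z h : 0 < r -> cabs z + cabs h + r < s -> bholo s K g ->
  nrm (g (z + h) - g z) <= 2 * K / r * cabs h.
Proof.
move=> r0 zhr hg; have K0 : 0 <= K.
  by apply: bholo_ge0 hg; have := cabs_ge0 z; have := cabs_ge0 h; lra.
apply: mean_value_le => [|t t01]; first by rewrite !mulr_ge0 // invr_ge0 ltW.
have lt : cabs (z + t%:C * h) < s - r by apply: cabs_conv_lt => //; lra.
exists (cderiv g (z + t%:C * h)).
  apply: cderivP; apply: hg.1; lra.
by apply: cderiv_le hg; rewrite // -ltrBrDr.
Qed.

(** The Cauchy estimate on the disc of radius s / 4, applied to g(w + z) - g(z), which is there at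
    most 8 K |w| / s. *)
Lemma cderiv_lip s K g w : 0 < s -> bholo s K g -> cabs w < s / 4 ->
  nrm (cderiv g w - cderiv g 0) <= 64 * K / s ^+ 2 * cabs w.
Proof.
move=> s0 hg ws; have w0 := cabs_ge0 w.
pose D z := g (w + z) + -1 *: g z.
have [hD _] : bholo (s / 2) (K + cabs (-1) * K) D.
  apply: bholoD; first by apply: bholo_shift hg; lra.
  have := bholo_shift (r := s / 2) (w := 0) _ hg; rewrite cabs0 add0r.
  rewrite (_ : (fun z => g (0 + z)) = g); last by apply: funext => z; rewrite add0r.
  by move=> h; apply: bholoZ; apply: h; lra.
have DK z : cabs z <= s / 4 -> nrm (D z) <= 2 * K / (s / 4) * cabs w.
  move=> zs; rewrite /D scaleN1r (addrC w).
  by apply: bholo_lip hg; [rewrite divr_gt0|lra].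
have cd : is_cd D 0 (cderiv g w + -1 *: cderiv g 0).
  apply: is_cdD; first by rewrite -is_cd_shift addr0; apply: cderivP; apply: hg.1; lra.
  by apply: is_cdZ; apply: cderivP; apply: hg.1; rewrite cabs0.
have s4 : 0 < s / 4 by lra.
have := cauchy_estimate s4 _ DK cd; rewrite scaleN1r.
have -> : 2 * (2 * K / (s / 4) * cabs w) / (s / 4) = 64 * K / s ^+ 2 * cabs w.
  by field; rewrite gt_eqF.
by apply=> z zs; apply: hD; lra.
Qed.

(** The mean value inequality for g(w) - w g'(0), whose derivative is controlled by [cderiv_lip]. *)
Lemma taylor1 s K g z : 0 < s -> bholo s K g -> cabs z < s / 4 ->
  nrm (g z - g 0 - z *: cderiv g 0) <= 64 * K / s ^+ 2 * cabs z ^+ 2.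
Proof.
move=> s0 hg zs; have K0 := bholo_ge0 s0 hg; have z0 := cabs_ge0 z.
pose phi w := g w - w *: cderiv g 0.
have -> : g z - g 0 - z *: cderiv g 0 = phi (0 + z) - phi 0.
  by rewrite /phi add0r; module_eq C.
rewrite expr2 mulrA; apply: mean_value_le => [|t /andP[t0 t1]].
  by rewrite !mulr_ge0 // invr_ge0 sqr_ge0.
have le : cabs (0 + t%:C * z) <= cabs z.
  by rewrite add0r cabsM cabs_real ger0_norm // ler_piMl.
exists (cderiv g (0 + t%:C * z) - cderiv g 0).
  by apply: is_cdB; [apply: cderivP; apply: hg.1; lra|apply: is_cd_lin].
apply: le_trans (cderiv_lip s0 hg _) _; first lra.
by rewrite ler_wpM2l // !mulr_ge0 // invr_ge0 sqr_ge0.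
Qed.

Lemma is_cd_quadratic g r B l : 0 < r -> 0 <= B ->
  (forall z, cabs z < r -> nrm (g z - g 0 - z *: l) <= B * cabs z ^+ 2) -> is_cd g 0 l.
Proof.
move=> r0 B0 gB e e0; have B1 : 0 < B + 1 by lra.
exists (Num.min r (e / (B + 1))) => [|h]; rewrite lt_min ?r0 ?divr_gt0 //.
rewrite ltr_pdivlMr // => /andP[/gB h1 h2]; rewrite add0r; apply: le_trans h1 _.
rewrite expr2 mulrA ler_wpM2r ?cabs_ge0 //; have := cabs_ge0 h; lra.
Qed.
End BoundedHolomorphic.

(** * Uniform limits, and differentiability of the derivative *)

Section UniformLimits.
Variables (R : realType) (F : completeNormedModType R[i]).
Local Notation C := R[i].
Implicit Types (g : C -> F) (z w : C) (s r K : R).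

Definition nrm_cvg (x : nat -> F) (l : F) :=
  forall e : R, 0 < e -> exists N, forall n, (N <= n)%N -> nrm (x n - l) <= e.

Lemma nrm_complete (x : nat -> F) :
  (forall e : R, 0 < e -> exists N, forall m n, (N <= m)%N -> (N <= n)%N -> nrm (x m - x n) <= e) ->
  exists l, nrm_cvg x l.
Proof.
move=> xC.
have : cvg (x @ \oo).
  apply: cauchy_cvg; apply: cauchy_exP => e /complex_gt0[-> e0].
  have e2 : 0 < complex.Re e / 2 by lra.
  have [N NP] := xC _ e2; exists (x N); exists N => // n /= Nn.
  rewrite -ball_normE /ball_ /= nrmE ltcR.
  by apply: le_lt_trans (NP _ _ (leqnn N) Nn) _; lra.
move=> /cvg_ex[l xl]; exists l => e e0.
have e0' : 0 < e%:C by rewrite ltcR.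
have [N _ NP] := (cvg_ballP _ _).1 xl _ e0'.
exists N => n /NP /=; rewrite -ball_normE /ball_ /= nrmE ltcR nrmBC => /ltW //.
Qed.

Lemma nrm_cvg_le (x : nat -> F) l c : nrm_cvg x l -> (forall n, nrm (x n) <= c) -> nrm l <= c.
Proof.
move=> xl xc; apply/ler_addgt0Pr => e /xl[N /(_ N (leqnn N)) h].
have -> : l = x N - (x N - l) by rewrite opprB addrC subrK.
by apply: le_trans (nrmB _ _) (lerD (xc N) h).
Qed.

Lemma nrm_cvgD (x y : nat -> F) l m : nrm_cvg x l -> nrm_cvg y m -> nrm_cvg (fun n => x n + y n) (l + m).
Proof.
move=> xl ym e e0; have e2 : 0 < e / 2 by lra.
have [N NP] := xl _ e2; have [M MP] := ym _ e2.
exists (maxn N M) => n; rewrite geq_max => /andP[/NP h1 /MP h2].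
rewrite opprD addrACA; apply: le_trans (nrmD _ _) _; lra.
Qed.

Lemma nrm_cvgZ (a : C) (x : nat -> F) l : nrm_cvg x l -> nrm_cvg (fun n => a *: x n) (a *: l).
Proof.
move=> xl e e0; have a0 : 0 < cabs a + 1 by have := cabs_ge0 a; lra.
have [N NP] := xl _ (divr_gt0 e0 a0); exists N => n /NP h.
rewrite -scalerBr nrmZ; apply: le_trans (ler_wpM2l (cabs_ge0 a) h) _.
rewrite mulrCA ler_piMr ?(ltW e0) // ler_pdivrMr //; lra.
Qed.

Lemma nrm_cvg_unique (x : nat -> F) l m : nrm_cvg x l -> nrm_cvg x m -> l = m.
Proof.
move=> xl xm; apply/eqP; rewrite -subr_eq0; apply/eqP/nrm_eq0/eqP.
rewrite eq_le nrm_ge0 andbT.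
have := nrm_cvgD xl (nrm_cvgZ (-1) xm); rewrite scaleN1r => /nrm_cvg_le; apply=> n.
by rewrite scaleN1r subrr nrm0.
Qed.

(** The Cauchy estimate for differences makes the derivatives at 0 a Cauchy sequence, and the
    remainder bound [taylor1] passes to the limit. Its explicit constant is kept because Frechet
    differentiability needs uniformity over all lines. *)
Lemma weierstrass (g_ : nat -> C -> F) g s K : 0 < s -> (forall n, bholo s K (g_ n)) ->
  (forall e : R, 0 < e -> exists N, forall n, (N <= n)%N -> forall z, cabs z < s ->
     nrm (g_ n z - g z) <= e) ->
  exists l, nrm_cvg (fun n => cderiv (g_ n) 0) l /\
   forall z, cabs z < s / 4 -> nrm (g z - g 0 - z *: l) <= 64 * K / s ^+ 2 * cabs z ^+ 2.
Proof.
move=> s0 hg unif.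
have cd n : is_cd (g_ n) 0 (cderiv (g_ n) 0).
  by apply: cderivP; apply: (hg n).1; rewrite cabs0.
have [l lP] : exists l, nrm_cvg (fun n => cderiv (g_ n) 0) l.
  apply: nrm_complete => e e0.
  have e' : 0 < e * s / 8 by rewrite divr_gt0 // mulr_gt0.
  have [N NP] := unif _ e'; exists N => m n Nm Nn.
  have s2 : 0 < s / 2 by lra.
  have -> : e = 2 * (2 * (e * s / 8)) / (s / 2) by field; rewrite gt_eqF.
  apply: (cauchy_estimate s2 _ _ (is_cdB (cd m) (cd n))) => z zs.
    have zs' : cabs z < s by lra.
    have [a aP] := (hg m).1 z zs'; have [b bP] := (hg n).1 z zs'.
    by exists (a - b); apply: is_cdB.
  have zs' : cabs z < s by lra.
  apply: le_trans (nrm_triB _ (g z) _) _; rewrite (nrmBC (g z)).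
  by have := NP _ Nm _ zs'; have := NP _ Nn _ zs'; lra.
exists l; split=> // z zs.
have pt w : cabs w < s -> nrm_cvg (fun n => g_ n w) (g w).
  by move=> ws e /unif[N NP]; exists N => n /NP; apply.
have c0 : nrm_cvg (fun n => g_ n 0) (g 0) by apply: pt; rewrite cabs0.
have cz : nrm_cvg (fun n => g_ n z) (g z) by apply: pt; lra.
have := nrm_cvgD (nrm_cvgD cz (nrm_cvgZ (-1) c0)) (nrm_cvgZ (-1) (nrm_cvgZ z lP)).
rewrite !scaleN1r => /nrm_cvg_le; apply=> n; rewrite !scaleN1r.
exact: taylor1.
Qed.

(** The derivative is a uniform limit of difference quotients with steps tending to 0. These are
    uniformly bounded by [bholo_lip], so [weierstrass] applies to them. *)
Lemma cderiv_is_cd g s K z : bholo s K g -> cabs z < s -> exists l, is_cd (cderiv g) z l.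
Proof.
move=> hgs zs; pose t := s - cabs z; have t0 : 0 < t by rewrite /t; lra.
have {hgs}hg : bholo t K (fun x => g (z + x)) by apply: bholo_shift hgs; rewrite /t; lra.
suff [l lP] : exists l, is_cd (cderiv (fun x => g (z + x))) 0 l.
  exists l; rewrite -[z]addr0 is_cd_shift.
  have <- // : cderiv (fun x => g (z + x)) = (fun x => cderiv g (z + x)).
  by apply: funext => x; apply: cderiv_shift.
move: (fun x => g (z + x)) hg => {zs}h hh; have K0 := bholo_ge0 t0 hh.
pose w n : C := (t / 16 / n.+1%:R)%:C.
have w0 n : 0 < t / 16 / n.+1%:R by rewrite divr_gt0 // divr_gt0.
have aw n : cabs (w n) = t / 16 / n.+1%:R by rewrite cabs_real gtr0_norm.
have aw1 n : cabs (w n) <= t / 16.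
  by rewrite aw ler_piMr ?invf_le1 ?ler1n // divr_ge0 // ltW.
have wn0 n : w n != 0.
  by apply/eqP => E; have := w0 n; rewrite -aw E cabs0 ltxx.
clearbody w.
pose h_ n x := (w n)^-1 *: (h (w n + x) + -1 *: h x).
have t2 : 0 < t / 2 by lra.
have shift x : cabs x < t / 2 -> bholo (t / 2) K (fun y => h (x + y)).
  by move=> xt; apply: bholo_shift hh; lra.
have hh_ n : bholo (t / 2) (16 * K / t) (h_ n).
  have [cd _] : bholo (t / 2) (cabs (w n)^-1 * (K + cabs (-1) * K)) (h_ n).
    apply: bholoZ; apply: bholoD; first by apply: bholo_shift hh; have := aw1 n; lra.
    apply: bholoZ; have := shift 0; rewrite cabs0 => /(_ t2).
    by rewrite (_ : (fun z => h (0 + z)) = h) //; apply: funext => x; rewrite add0r.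
  split=> // x xt; rewrite /h_ nrmZ cabsV scaleN1r (addrC (w n)) mulrC ler_pdivrMr ?aw // -aw.
  have t8 : 0 < t / 8 by lra.
  have -> : 16 * K / t = 2 * K / (t / 8) by field; rewrite gt_eqF.
  by apply: bholo_lip hh => //; have := aw1 n; lra.
have unif (e : R) : 0 < e -> exists N, forall n, (N <= n)%N -> forall x, cabs x < t / 2 ->
    nrm (h_ n x - cderiv h x) <= e.
  (* By [taylor1] at x the n-th quotient is within 16 K / t / (n + 1) of the derivative. *)
  move=> e0; exists (Num.bound (16 * K / t / e)) => n Nn x xt.
  have -> : h_ n x - cderiv h x =
     (w n)^-1 *: (h (x + w n) - h (x + 0) - w n *: cderiv (fun y => h (x + y)) 0).
    have -> : cderiv (fun y => h (x + y)) 0 = cderiv h x by rewrite cderiv_shift addr0.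
    have -> : h (x + w n) = h (w n + x) by congr h; ring.
    by have wn := wn0 n; rewrite (addr0 x) /h_; module_eq C.
  rewrite nrmZ cabsV mulrC ler_pdivrMr ?aw // -aw.
  apply: le_trans (taylor1 t2 (shift _ xt) _) _; first by have := aw1 n; lra.
  rewrite (expr2 (cabs _)) [leLHS]mulrA ler_wpM2r ?cabs_ge0 // aw.
  have -> : 64 * K / (t / 2) ^+ 2 * (t / 16 / n.+1%:R) = 16 * K / t / n.+1%:R.
    have : 0 < n.+1%:R :> R by rewrite ltr0n.
    by move: n.+1%:R => m m0; field; rewrite !gt_eqF.
  rewrite ler_pdivrMr // [leRHS]mulrC -ler_pdivrMr //.
  have B0 : 0 <= 16 * K / t / e by rewrite !mulr_ge0 // invr_ge0 ltW.
  apply: le_trans (ltW (archi_boundP B0)) _.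
  by rewrite ler_nat; apply: leqW.
have [l [_ lP]] := weierstrass t2 hh_ unif; exists l.
apply: is_cd_quadratic lP; first by lra.
by rewrite !mulr_ge0 ?invr_ge0 ?sqr_ge0 // ltW.
Qed.
End UniformLimits.

(** * Taylor coefficients as iterated divided differences *)

Section DividedDifference.
Variables (R : realType) (F : completeNormedModType R[i]).
Local Notation C := R[i].
Implicit Types (g h : C -> F) (z w : C) (s r K : R).

(** On power series this is the shift of coefficients, so for holomorphic g the value of the j-th
    iterate at 0 is the j-th Taylor coefficient. *)
Definition dquot g z : F := if z == 0 then cderiv g 0 else z^-1 *: (g z - g 0).

(** For |z| < s / 2 the bound is the Lipschitz estimate; beyond, it is 2 K divided by |z| >= s / 2.
    At 0 the quotient is differentiable because g has a second derivative there. *)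
Lemma bholo_dquot s K g : 0 < s -> bholo s K g -> bholo s (4 / s * K) (dquot g).
Proof.
move=> s0 hg; have K0 := bholo_ge0 s0 hg; split=> z zs; last first.
  have s2 : 0 < s / 2 by lra.
  have -> : 4 / s * K = 2 * K / (s / 2) by field; rewrite gt_eqF.
  rewrite /dquot; case: eqVneq => [_|z0].
    by apply: cderiv_le hg; rewrite ?cabs0; lra.
  have cz := cabs_gt0 z0.
  rewrite nrmZ cabsV mulrC ler_pdivrMr //.
  have [lt|ge] := ltP (cabs z) (s / 2).
    rewrite -[z in g z]add0r; apply: bholo_lip hg; rewrite ?cabs0; lra.
  apply: le_trans (nrmB _ _) _.
  have h1 := hg.2 _ zs; have h2 : nrm (g 0) <= K by apply: hg.2; rewrite cabs0.
  have : 2 * K / (s / 2) * (s / 2) <= 2 * K / (s / 2) * cabs z.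
    by rewrite ler_wpM2l // !mulr_ge0 // invr_ge0 ltW.
  by rewrite divfK ?gt_eqF //; lra.
have [->|z0] := eqVneq z 0; last first.
  have [l lP] := hg.1 _ zs.
  have := is_cd_scale (is_cd_inv z0) (is_cdB lP (is_cd_cst (g 0) z)).
  set m := (X in is_cd _ _ X) => mP; exists m.
  apply: is_cd_near mP; first exact: cabs_gt0 z0.
  move=> w wz; rewrite /dquot; case: eqVneq => // w0.
  by move: wz; rewrite w0 sub0r cabsN ltxx.
have cs0 : cabs (0 : C) < s by rewrite cabs0.
have [l2 l2P] := cderiv_is_cd hg cs0.
exists (2^-1 *: l2) => e e0; have [d d0 dP] := l2P _ e0.
exists (Num.min d s) => [|h]; rewrite lt_min ?d0 // => /andP[hd hs].
rewrite add0r /dquot eqxx; case: eqVneq => [->|h0].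
  by rewrite subrr scale0r subr0 nrm0 cabs0 mulr0.
have ch := cabs_gt0 h0.
(* With the second order Taylor polynomial subtracted, the derivative at w is at most e |w|, and the
   mean value inequality bounds the increment by e |h|^2. *)
pose phi w := g w - w *: cderiv g 0 - w *: (w *: (2^-1 *: l2)).
have -> : h^-1 *: (g h - g 0) - cderiv g 0 - h *: (2^-1 *: l2) = h^-1 *: (phi (0 + h) - phi 0).
  by rewrite add0r /phi; module_eq C.
rewrite nrmZ cabsV mulrC ler_pdivrMr //.
apply: mean_value_le => [|t /andP[t0 t1]]; first by rewrite mulr_ge0 // ltW.
set w := 0 + _.
have wh : cabs w <= cabs h by rewrite /w add0r cabsM cabs_real ger0_norm // ler_piMl // ltW.
exists (cderiv g w - cderiv g 0 - w *: l2); last first.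
  have := dP w (le_lt_trans wh hd); rewrite add0r => /le_trans; apply.
  by rewrite ler_wpM2l // ltW.
have sq := is_cd_scale (is_cd_lin (1 : C^o) w) (is_cd_lin (2^-1 *: l2) w).
have := is_cdB (is_cdB (cderivP (hg.1 _ (le_lt_trans wh hs))) (is_cd_lin (cderiv g 0) w)) sq.
have -> : w *: (2^-1 *: l2) = (w *: (1 : C^o) : C) *: (2^-1 *: l2).
  by rewrite /GRing.scale /= mulr1.
have -> : (w *: (1 : C^o) : C) *: (2^-1 *: l2) + 1 *: ((w *: (1 : C^o) : C) *: (2^-1 *: l2)) = w *: l2.
  by rewrite [w *: _]mulr1; module_eq C.
by congr is_cd; apply: funext => x; rewrite [x *: (1 : C^o)]mulr1.
Qed.

(** This bounds Taylor coefficients and remainders alike, with geometric decay as soon as s > 4. *)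
Lemma bholo_iter_dquot s K g j : 0 < s -> bholo s K g ->
  bholo s ((4 / s) ^+ j * K) (iter j dquot g).
Proof.
move=> s0 hg; elim: j => [|j IH]; first by rewrite expr0 mul1r.
by rewrite exprS -mulrA; apply: bholo_dquot.
Qed.

Lemma iter_dquotD s K L g h j : 0 < s -> bholo s K g -> bholo s L h ->
  iter j dquot (fun z => g z + h z) = (fun z => iter j dquot g z + iter j dquot h z).
Proof.
move=> s0 hg hh; elim: j => //= j ->; apply: funext => z.
have cs0 : cabs (0 : C) < s by rewrite cabs0.
rewrite /dquot; case: eqP => _; last by module_eq C.
have c1 := cderivP ((bholo_iter_dquot j s0 hg).1 _ cs0).
have c2 := cderivP ((bholo_iter_dquot j s0 hh).1 _ cs0).
exact: cderivE (is_cdD c1 c2).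
Qed.

Lemma iter_dquotZ s K g (a : C) j : 0 < s -> bholo s K g ->
  iter j dquot (fun z => a *: g z) = (fun z => a *: iter j dquot g z).
Proof.
move=> s0 hg; elim: j => //= j ->; apply: funext => z.
have cs0 : cabs (0 : C) < s by rewrite cabs0.
rewrite /dquot; case: eqP => _; last by module_eq C.
have c1 := cderivP ((bholo_iter_dquot j s0 hg).1 _ cs0).
exact: cderivE (is_cdZ a c1).
Qed.

(** Taylor's formula at z = 1, by telescoping f(1) = f(0) + [dquot f 1] along the iterates. *)
Lemma dquot_expansion g J :
  nrm (g 1) <= \sum_(j < J) nrm (iter j dquot g 0) + nrm (iter J dquot g 1).
Proof.
elim: J => [|J IH]; first by rewrite big_ord0 add0r.
apply: le_trans IH _; rewrite big_ord_recr /= -addrA lerD2l.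
have -> : iter J dquot g 1 = iter J dquot g 0 + dquot (iter J dquot g) 1.
  by rewrite /dquot oner_eq0 invr1 scale1r addrC subrK.
exact: nrmD.
Qed.
End DividedDifference.

(** * Differentiability in normed spaces *)

Section Neighborhoods.
Variables (R : realType) (V : normedModType R[i]).
Local Notation C := R[i].

Lemma nbhs_nrm (x : V) (P : set V) :
  nbhs x P <-> exists2 r : R, 0 < r & forall y, nrm (y - x) < r -> P y.
Proof.
split=> [/nbhs_ballP[e /= /complex_gt0[-> e0] eP]|[r r0 rP]].
  exists (complex.Re e) => // y yx; apply: eP.
  by rewrite -ball_normE /ball_ /= nrmE ltcR nrmBC.
apply/nbhs_ballP; exists r%:C => [/=|y]; first by rewrite ltcR.
by rewrite -ball_normE /ball_ /= nrmE ltcR nrmBC => /rP.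
Qed.

End Neighborhoods.

Section Frechet.
Variables (R : realType) (V W : normedModType R[i]).
Local Notation C := R[i].

Lemma remainderE (f L : V -> W) x h :
  (f \o shift x - (cst (f x) + L)) h = f (x + h) - f x - L h.
Proof.
rewrite -[LHS]/(f (h + x) - (f x + L h)) (addrC h) opprD addrA //.
Qed.

Lemma differentiable_nrm (f : V -> W) x : differentiable f x ->
  exists D : {linear V -> W}, forall e : R, 0 < e -> exists2 d : R, 0 < d &
    forall h, nrm h < d -> nrm (f (x + h) - f x - D h) <= e * nrm h.
Proof.
move=> /diff_locally E; exists ('d f x) => e e0.
have e0' : 0 < e%:C by rewrite ltcR.
have /eqaddoP/(_ _ e0') := E.
move=> /nbhs_nrm[d d0 dP]; exists d => // h hd.
have := dP h; rewrite subr0 => /(_ hd).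
by rewrite (nrmE h) nrmE -rmorphM lecR remainderE.
Qed.

(** The bound on [D] makes it continuous, and the quadratic remainder is o(h), so [D] is the
    differential. *)
Lemma nrm_differentiable (f : V -> W) x (D : V -> W) r B : 0 < r -> 0 <= B ->
  linear D -> (forall h, nrm (D h) <= B * nrm h) ->
  (forall h, nrm h < r -> nrm (f (x + h) - f x - D h) <= B * nrm h ^+ 2) ->
  differentiable f x.
Proof.
move=> r0 B0 Dlin DB fD.
pose L : {linear V -> W} := HB.pack D (GRing.isLinear.Build C V W *:%R D Dlin).
have Lc : continuous L.
  move=> y P /nbhs_nrm[e e0 eP]; apply/nbhs_nrm; exists (e / (B + 1)).
    by rewrite divr_gt0 //; lra.
  move=> z; rewrite ltr_pdivlMr; last by lra.
  move=> zy; apply: eP; rewrite -linearB; apply: le_lt_trans (DB _) _.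
  have := nrm_ge0 (z - y); lra.
have E : f \o shift x = cst (f x) + L +o_0 id.
  apply/eqaddoP => eps /complex_gt0[]; move: (complex.Re eps) => e -> e0.
  apply/nbhs_nrm; exists (Num.min r (e / (B + 1))).
    by rewrite lt_min r0 divr_gt0 //; lra.
  move=> h; rewrite subr0 lt_min ltr_pdivlMr; last by lra.
  move=> /andP[hr he]; rewrite (nrmE h) nrmE -rmorphM lecR remainderE.
  apply: le_trans (fD h hr) _.
  rewrite expr2 mulrA ler_wpM2r ?nrm_ge0 //; have := nrm_ge0 h; lra.
by apply/diff_locallyP; rewrite (diff_unique Lc E).
Qed.
End Frechet.

(** * Holomorphic maps in charts *)

Section Charts.
Variables (R : realType) (M : topologicalType) (A : cBanachManifold R M).
Variable F : completeNormedModType R[i].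
Local Notation C := R[i].
Implicit Types (f g : M -> F) (i : chart_idx A) (x p : M) (W : set M).

Lemma holo_mapD f g : holo_map A f -> holo_map A g -> holo_map A (f \+ g).
Proof.
move=> fh gh i; have [a [ah af]] := fh i; have [b [bh bg]] := gh i.
exists (a + b); split=> [m mi|p ip].
  by apply: differentiableD; [apply: ah|apply: bh].
by rewrite -[LHS]/(a (chart i p) + b (chart i p)) af // bg.
Qed.

Lemma holo_mapZ (k : C) f : holo_map A f -> holo_map A (fun x => k *: f x).
Proof.
move=> fh i; have [a [ah af]] := fh i; exists (k *: a); split=> [m mi|p ip].
  by apply: differentiableZ; apply: ah.
by rewrite -[LHS]/(k *: a (chart i p)) af.
Qed.

Lemma subr_funE f g : f \- g = f \+ (fun x => -1 *: g x).
Proof. by apply: funext => x /=; rewrite scaleN1r. Qed.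

Lemma holo_mapB f g : holo_map A f -> holo_map A g -> holo_map A (f \- g).
Proof. by move=> fh gh; rewrite subr_funE; apply: holo_mapD fh (holo_mapZ _ gh). Qed.

(** Off the image of the chart the value is the default point x. *)
Definition chart_inv i x (m : model i) : M := xget x [set p | dom i p /\ chart i p = m].

Lemma chart_invK i x p : dom i p -> chart_inv x (chart i p) = p.
Proof.
move=> ip; have [iq /= qp] := @xgetPex _ x [set q | dom i q /\ chart i q = chart i p]
  (ex_intro _ p (conj ip erefl)).
by apply: (chart_inj (c := A) (i := i)); rewrite ?inE.
Qed.

Definition chart_ball i W (c : model i) (r : R) :=
  forall m, nrm (m - c) < r -> exists p, [/\ W p, dom i p & chart i p = m].

Lemma chart_ball_ex i W x : open W -> W x -> dom i x ->
  exists2 r : R, 0 < r & chart_ball W (chart i x) r.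
Proof.
move=> Wo Wx ix.
have o : open (chart i @` (W `&` dom i)).
  by apply: chart_open; [apply: openI Wo (dom_open _)|move=> p []].
have : nbhs (chart i x) (chart i @` (W `&` dom i)).
  by apply: open_nbhs_nbhs; split=> //; exists x.
move=> /nbhs_nrm[r r0 rP]; exists r => // m /rP[p [Wp ip] pm]; by exists p.
Qed.

Lemma chart_ball_preimage i x (r : R) : dom i x -> 0 < r ->
  exists W, [/\ open W, W x & forall p, W p -> dom i p /\ nrm (chart i p - chart i x) < r].
Proof.
move=> ix r0; have := @chart_cont _ _ A i.
rewrite (continuous_open_subspace _ (dom_open i)) => /(_ x); rewrite inE => /(_ ix) cx.
have : nbhs (chart i x) [set m | nrm (m - chart i x) < r].
  by apply/nbhs_nrm; exists r.
move=> /cx N; exists (dom i `&` (chart i @^-1` [set m | nrm (m - chart i x) < r])°); split.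
- exact: openI (dom_open i) (open_interior _).
- by split=> //; apply: nbhs_singleton; apply: nbhs_interior N.
- by move=> p [ip /interior_subset].
Qed.

(** The chart image is open, so near [chart i p] the local representative of f agrees with the
    composite and passes its differential on. A single linear [D] serves all directions. *)
Lemma holo_map_frechet f i x p : holo_map A f -> dom i p ->
  exists D : {linear model i -> F},
    forall v, is_cd (fun z => (f \o chart_inv x) (chart i p + z *: v)) 0 (D v).
Proof.
move=> /(_ i)[g [gh gf]] ip.
have gfi m : (chart i @` dom i) m -> g m = f (chart_inv x m).
  by move=> [q iq <-]; rewrite chart_invK // gf.
have [D DP] := differentiable_nrm (gh _ (ex_intro2 _ _ p ip erefl)).
exists D => v; have [r r0 rP] := chart_ball_ex openT (I : [set: M] p) ip.
have v0 := nrm_ge0 v; have v1 : 0 < nrm v + 1 by lra.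
have lin (z : C) (e : R) : 0 < e -> cabs z < e / (nrm v + 1) -> nrm (z *: v) < e.
  move=> e0; rewrite ltr_pdivlMr // nrmZ; have := cabs_ge0 z; lra.
apply: (@is_cd_near _ _ (fun z => g (chart i p + z *: v)) _ 0 _ (r / (nrm v + 1))).
- by rewrite divr_gt0.
- move=> z; rewrite subr0 => /(lin _ _ r0) zr /=; apply: gfi.
  have [|q [_ iq <-]] := rP (chart i p + z *: v); last by exists q.
  by rewrite addrAC subrr add0r.
move=> e e0; have [d d0 dP] := DP _ (divr_gt0 e0 v1).
exists (d / (nrm v + 1)) => [|z zd]; first by rewrite divr_gt0.
rewrite add0r scale0r addr0 -linearZ; apply: le_trans (dP _ (lin _ _ d0 zd)) _.
rewrite nrmZ mulrAC ler_pdivrMr // -mulrA ler_wpM2l ?(ltW e0) //.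
by rewrite ler_wpM2l ?cabs_ge0 //; lra.
Qed.

(** Restriction to complex lines brings the one-variable theory to bear; s |v| <= r keeps the disc
    inside the ball. *)
Lemma bholo_line f i x (c : model i) r W K s v : holo_map A f -> chart_ball W c r ->
  (forall p, W p -> nrm (f p) <= K) -> 0 < r -> s * nrm v <= r ->
  bholo s K (fun z => (f \o chart_inv x) (c + z *: v)).
Proof.
move=> fh cb fK r0 sv.
have inb z : cabs z < s -> exists p, [/\ W p, dom i p & chart i p = c + z *: v].
  move=> zs; apply: cb; rewrite addrAC subrr add0r nrmZ.
  have := nrm_ge0 v; rewrite le_eqVlt => /orP[/eqP <-|v0]; first by rewrite mulr0.
  by apply: lt_le_trans sv; rewrite ltr_pM2r.
split=> z /inb[p [Wp ip pm]]; last by rewrite /= -pm chart_invK //; apply: fK.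
have [D DP] := holo_map_frechet x fh ip; exists (D v).
rewrite -[z]addr0 is_cd_shift; have := DP v.
set g1 := (X in is_cd X 0 _); set g2 := (X in _ -> is_cd X 0 _).
have -> // : g1 = g2 by apply: funext => w; rewrite /g1 /g2 /= pm scalerDl addrA.
Qed.

Lemma holo_map_bounded_near f x : holo_map A f ->
  exists W K, [/\ open W, W x & forall p, W p -> nrm (f p) <= K].
Proof.
move=> fh; have [i ix] := dom_cover A x.
have [g [gh gf]] := fh i.
have gc := differentiable_continuous (gh _ (ex_intro2 _ _ x ix erefl)).
have : nbhs (g (chart i x)) [set y | nrm (y - g (chart i x)) < 1] by apply/nbhs_nrm; exists 1.
move=> /gc /nbhs_nrm[r r0 rP].
have [W [Wo Wx WP]] := chart_ball_preimage ix r0.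
exists W, (nrm (f x) + 1); split=> // p /WP[ip /rP /=]; rewrite !gf // => h.
rewrite -(subrK (f x) (f p)) addrC; apply: le_trans (nrmD _ _) _; lra.
Qed.
End Charts.

(** * Continuous seminorms and local behaviour of Cauchy sequences *)

Lemma finite_bound (R : realType) (T : eqType) (b : T -> R) (s : seq T) :
  exists2 B : R, 0 <= B & forall x, x \in s -> b x <= B.
Proof.
elim: s => [|y s [B B0 BP]]; first by exists 0.
exists (Num.max B (b y)) => [|x]; first by rewrite le_max B0.
rewrite inE le_max => /orP[/eqP->|/BP->//]; by rewrite lexx orbT.
Qed.

Section SupSeminorm.
Variables (R : realType) (M : topologicalType) (A : cBanachManifold R M).
Variable F : completeNormedModType R[i].
Variables (I : Type) (i0 : I) (e : I -> (M -> F) -> F).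
Local Notation C := R[i].
Implicit Types (f g : M -> F) (x p : M) (W : set M).

(* A family of linear functionals is locally dominated when finitely many
   points dominate it, however small the prescribed neighbourhoods of all
   points are; this is what makes the supremum of the family
   tau_delta-continuous. *)
Definition locally_dominated := forall W : M -> set M, (forall x, open (W x) /\ W x x) ->
  exists (xs : seq M) (c : R), 0 <= c /\ forall f d, holo_map A f -> 0 <= d ->
    (forall x, x \in xs -> forall p, W x p -> nrm (f p) <= d) ->
    forall i, nrm (e i f) <= c * d.

Hypothesis eD : forall i f g, holo_map A f -> holo_map A g -> e i (f \+ g) = e i f + e i g.
Hypothesis eZ : forall i (k : C) f, holo_map A f -> e i (fun x => k *: f x) = k *: e i f.
Hypothesis edom : locally_dominated.

(** Domination is applied to neighbourhoods on which f is bounded; only finitely many of the bounds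
    matter. Thus the supremum below is finite. *)
Lemma dominated_bounded f : holo_map A f -> exists B, forall i, nrm (e i f) <= B.
Proof.
move=> fh.
have /choice[W0 /choice[K WK]] : forall x, exists W K, [/\ open W, W x & forall p, W p -> nrm (f p) <= K].
  by move=> x; apply: (holo_map_bounded_near x fh).
have [|xs [c [c0 cP]]] := edom (W := W0); first by move=> x; have [] := WK x.
have [B B0 BP] := finite_bound K xs.
exists (c * B) => i; apply: cP => // x xxs p Wp.
by have [_ _ h] := WK x; apply: le_trans (h _ Wp) (BP _ xxs).
Qed.

Definition sup_seminorm f : R := sup (range (fun i => nrm (e i f))).

Lemma le_sup_seminorm f i : holo_map A f -> nrm (e i f) <= sup_seminorm f.
Proof.
move=> /dominated_bounded[B BP]; apply: ub_le_sup; last by exists i.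
by exists B => _ [j _ <-].
Qed.

Lemma sup_seminorm_le f B : (forall i, nrm (e i f) <= B) -> sup_seminorm f <= B.
Proof.
by move=> eB; apply: ge_sup; [exists (nrm (e i0 f)), i0|move=> _ [j _ <-]].
Qed.

Lemma le_supnorm (U : set M) f (d : R) p : (supnorm U f < d%:E)%E -> U p -> nrm (f p) <= d.
Proof.
move=> Ud Up; rewrite -lee_fin; apply: le_trans (ltW Ud).
by apply: ereal_sup_ubound; exists p.
Qed.

(** For a cover U, each point x receives a member U (k x) containing it. Domination by finitely many
    points then involves only finitely many seminorms of the cover, those of index at most the
    largest k x. *)
Lemma tau_delta_sup_seminorm : tau_delta_seminorm A sup_seminorm.
Proof.
split; first split=> [f fh|f g fh gh|k f fh].
- exact: le_trans (nrm_ge0 _) (le_sup_seminorm i0 fh).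
- apply: sup_seminorm_le => i; rewrite eD //; apply: le_trans (nrmD _ _) _.
  by apply: lerD; apply: le_sup_seminorm.
- rewrite -/(cabs k); apply/eqP; rewrite eq_le; apply/andP; split.
    apply: sup_seminorm_le => i; rewrite eZ // nrmZ ler_wpM2l ?cabs_ge0 //.
    exact: le_sup_seminorm.
  have kh := holo_mapZ k fh.
  have [->|k0] := eqVneq k 0.
    by rewrite cabs0 mul0r; apply: le_trans (nrm_ge0 _) (le_sup_seminorm i0 (holo_mapZ 0 fh)).
  rewrite mulrC -ler_pdivlMr ?cabs_gt0 //; apply: sup_seminorm_le => i.
  rewrite ler_pdivlMr ?cabs_gt0 // mulrC -nrmZ -eZ //; exact: le_sup_seminorm.
move=> U [Uo Uc] eps eps0; have [k kP] := choice Uc.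
have [|xs [c [c0 cP]]] := edom (W := U \o k); first by move=> x /=.
have c1 : 0 < c + 1 by lra.
have d0 : 0 < eps / (c + 1) / 2 by rewrite !divr_gt0.
exists (\max_(x <- xs) k x).+1, (eps / (c + 1) / 2); split=> // f [fh _] fU.
have le : sup_seminorm f <= c * (eps / (c + 1) / 2).
  apply: sup_seminorm_le => i; apply: cP => //; first exact: ltW.
  move=> x xxs p; apply: le_supnorm; apply: fU; rewrite ltnS.
  exact: (@leq_bigmax_seq _ _ _ k).
apply: le_lt_trans le _.
have -> : c * (eps / (c + 1) / 2) = eps * (c / (c + 1) / 2) by ring.
rewrite gtr_pMr // ltr_pdivrMr // mul1r ltr_pdivrMr //; lra.
Qed.

Lemma tau_delta_cauchy_dominated u : tau_delta_cauchy A u ->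
  forall eps : R, 0 < eps -> exists N, forall m n, (N <= m)%N -> (N <= n)%N ->
    forall i, nrm (e i (u m) - e i (u n)) <= eps.
Proof.
move=> [uh /(_ _ tau_delta_sup_seminorm) uC] eps /uC[N NP].
exists N => m n Nm Nn i.
have -> : e i (u m) - e i (u n) = e i (u m \- u n).
  by rewrite subr_funE eD ?eZ ?scaleN1r //; apply: holo_mapZ.
by apply: le_trans (ltW (NP _ _ Nm Nn)); apply: le_sup_seminorm; apply: holo_mapB.
Qed.
End SupSeminorm.

Section LocalBounds.
Variables (R : realType) (M : topologicalType) (A : cBanachManifold R M).
Variable F : completeNormedModType R[i].
Local Notation C := R[i].
Variable u : nat -> M -> F.
Hypothesis uC : tau_delta_cauchy A u.

(** Otherwise there are points y_k tending to x at which some u_n exceeds k in norm. Evaluations at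
    the y_k are dominated, so the u_n are uniformly Cauchy, hence uniformly bounded, on them. *)
Lemma tau_delta_cauchy_locally_bounded x : @second_countable M ->
  exists W K, [/\ open W, W x & forall n p, W p -> nrm (u n p) <= K].
Proof.
move=> [B /countable_injP[idx idx_inj] [Bo Bbase]].
apply: contrapT => nW.
pose E n := xget setT [set U | [/\ B U, U x & idx U = n]].
have EP n : open (E n) /\ E n x.
  by rewrite /E; case: xgetP => [U _ [/Bo]|]; last by split=> //; apply: openT.
pose W k := fun p => forall n, (n < k)%N -> E n p.
have W0 k : open (W k) /\ W k x.
  elim: k => [|k [Wo Wx]].
    have -> : W 0%N = setT by apply/seteqP; split=> // p _ n; rewrite ltn0.
    by split; first exact: openT.
  have -> : W k.+1 = W k `&` E k.
    apply/seteqP; split=> p; first by move=> h; split=> [n nk|]; apply: h => //; exact: leqW.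
    by move=> [h1 h2] n; rewrite ltnS leq_eqVlt => /orP[/eqP->//|/h1].
  by have [Eo Ex] := EP k; split; [apply: openI|split].
have Wbase U : open U -> U x -> exists N, forall k, (N <= k)%N -> W k `<=` U.
  move=> Uo Ux; have : nbhs x U by apply: open_nbhs_nbhs.
  move=> /Bbase[V [BV Vx] VU]; exists (idx V).+1 => k Nk p /(_ _ Nk) Ep; apply: VU.
  suff <- : E (idx V) = V by [].
  have [BE _ iE] := @xgetPex _ setT [set U | [/\ B U, U x & idx U = idx V]]
    (ex_intro _ V (And3 BV Vx erefl)).
  by apply: idx_inj => //; rewrite inE.
have /choice[y yP] : forall k : nat, exists q : M * nat, W k q.1 /\ k%:R < nrm (u q.2 q.1).
  move=> k; apply: contrapT => nq; apply: nW; exists (W k), k%:R.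
  have [Wo Wx] := W0 k; split=> // n p Wp; rewrite leNgt; apply/negP => lt.
  by apply: nq; exists (p, n).
pose e k (f : M -> F) := f (y k).1.
have edom : locally_dominated A e.
  move=> U Uo; have [N NP] := Wbase _ (Uo x).1 (Uo x).2.
  (* From index N on, the y_k lie in the neighbourhood of x; each earlier one dominates its own
     evaluation. *)
  exists (x :: [seq (y k).1 | k <- iota 0 N]), 1; split=> // f d fh d0 fd k.
  rewrite mul1r /e; have [kN|Nk] := ltnP k N.
    apply: (fd (y k).1); last exact: (Uo _).2.
    by rewrite inE (map_f (fun k => (y k).1)) ?orbT // mem_iota.
  by apply: (fd x); [rewrite mem_head|apply: NP Nk _ (yP k).1].
have [N NP] := tau_delta_cauchy_dominated 0%N (fun=> fun=> fun=> fun=> fun=> erefl)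
  (fun=> fun=> fun=> fun=> erefl) edom uC ltr01.
have /choice[b bP] n : exists b, forall k, nrm (u n (y k).1) <= b.
  by apply: (dominated_bounded edom); apply: uC.1.
(* [K] bounds u_0, ..., u_N on the y_k, and later terms differ from u_N by at most 1. *)
have [K K0 KP] := finite_bound b (iota 0 N.+1).
have bound n k : nrm (u n (y k).1) <= K + 1.
  have KN m : (m <= N)%N -> nrm (u m (y k).1) <= K.
    by move=> mN; apply: le_trans (bP m k) (KP _ _); rewrite mem_iota.
  have [/ltnW/KN|Nn] := ltnP n N; first by move=> h; lra.
  have := NP _ _ Nn (leqnn N) k; have := KN N (leqnn N); rewrite /e => h1 h2.
  by rewrite -(subrK (u N (y k).1) (u n _)); apply: le_trans (nrmD _ _) _; lra.
have K1 : 0 <= K + 1 by lra.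
have := archi_boundP K1; have [_] := yP (Num.bound (K + 1)).
by move=> /lt_le_trans/(_ (bound _ _)) h1 h2; lra.
Qed.

Lemma tau_delta_cauchy_locally_uniform x : @second_countable M ->
  exists W, [/\ open W, W x, exists K, forall n p, W p -> nrm (u n p) <= K &
    forall eps : R, 0 < eps -> exists N, forall m n, (N <= m)%N -> (N <= n)%N ->
      forall p, W p -> nrm (u m p - u n p) <= eps].
Proof.
move=> /(tau_delta_cauchy_locally_bounded x)[W [K [Wo Wx WK]]].
have [i ix] := dom_cover A x; set c := chart i x.
have [r r0 rP] := chart_ball_ex Wo Wx ix.
have r8 : 0 < r / 8 by lra.
pose line f v := fun z : C => (f \o chart_inv x) (c + z *: v) : F.
(* Directions shorter than r / 8 give functions of z bounded on the disc of radius 8, where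
   remainders decay like 2^-J at z = 1. *)
pose I := {v : model i | nrm v < r / 8}.
pose e j (v : I) (f : M -> F) := iter j (@dquot R F) (line f (sval v)) 0.
have i0 : I by exists 0; rewrite nrm0.
have bline (U : set M) r' f K' (v : I) : holo_map A f -> chart_ball U c r' -> 0 < r' ->
    (forall p, U p -> nrm (f p) <= K') -> bholo (r' / (r / 8)) K' (line f (sval v)).
  move=> fh cb r'0 fK; apply: (bholo_line _ fh cb fK r'0).
  rewrite mulrAC ler_pdivrMr // ler_wpM2l ?(ltW r'0) // ltW //; exact: svalP v.
have bline_ex f (v : I) : holo_map A f -> exists2 s, 0 < s & exists K', bholo s K' (line f (sval v)).
  move=> fh; have [U [K' [Uo Ux UK]]] := holo_map_bounded_near x fh.
  have [r' r'0 r'P] := chart_ball_ex Uo Ux ix.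
  by exists (r' / (r / 8)); [rewrite divr_gt0|exists K'; apply: bline UK].
have bholo_min (s t K' : R) (g : C -> F) : t <= s -> bholo s K' g -> bholo t K' g.
  by move=> ts [h1 h2]; split=> z zt; [apply: h1|apply: h2]; apply: lt_le_trans zt ts.
have eD j v f g : holo_map A f -> holo_map A g -> e j v (f \+ g) = e j v f + e j v g.
  move=> /(bline_ex _ v)[s s0 [Kf sf]] /(bline_ex _ v)[t t0 [Kg tg]].
  have m0 : 0 < Num.min s t by rewrite lt_min s0.
  have ms : Num.min s t <= s by rewrite ge_min lexx.
  have mt : Num.min s t <= t by rewrite ge_min lexx orbT.
  have := iter_dquotD j m0 (bholo_min _ _ _ _ ms sf) (bholo_min _ _ _ _ mt tg).
  by move=> /(congr1 (fun h => h 0)).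
have eZ j v (k : C) f : holo_map A f -> e j v (fun x => k *: f x) = k *: e j v f.
  move=> /(bline_ex _ v)[s s0 [Kf sf]].
  by have := iter_dquotZ k j s0 sf => /(congr1 (fun h => h 0)).
have edom j : locally_dominated A (e j).
  move=> U Uo; have [r' r'0 r'P] := chart_ball_ex (Uo x).1 (Uo x).2 ix.
  have s0 : 0 < r' / (r / 8) by rewrite divr_gt0.
  (* The point x alone dominates: a ball of any radius r' bounds the j-th coefficients, at the price
     of a constant depending on r' and j. *)
  exists [:: x], ((4 / (r' / (r / 8))) ^+ j); split.
    by rewrite exprn_ge0 // divr_ge0 // ltW.
  move=> f d fh d0 fd v.
  have bl := bline _ _ _ _ v fh r'P r'0 (fd x (mem_head _ _)).
  by apply: (bholo_iter_dquot j s0 bl).2; rewrite cabs0.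
have [W' [W'o W'x W'P]] := chart_ball_preimage ix r8.
exists (W `&` W'); split; [exact: openI|by []|by exists K => n p [/WK]|].
move=> eps eps0.
have K0 : 0 <= K by apply: le_trans (nrm_ge0 _) (WK 0%N x Wx).
have [J JP] : exists J, 2^-1 ^+ J * (K + K) <= eps / 2.
  have K1 : 0 < K + K + 1 by lra.
  have e1 : 0 < eps / 2 / (K + K + 1) by rewrite !divr_gt0.
  have [J /ltW JP] := half_pow_lt e1; exists J.
  have q0 : 0 <= (2^-1 : R) ^+ J by rewrite exprn_ge0 ?invr_ge0.
  move: JP; rewrite ler_pdivlMr //; lra.
(* The J low order coefficients share eps / 2; the successor avoids division by zero when J = 0. *)
have e2 : 0 < eps / 2 / J.+1%:R by rewrite !divr_gt0.
have /choice[N NP] j : exists N, forall m n, (N <= m)%N -> (N <= n)%N ->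
    forall v, nrm (e j v (u m) - e j v (u n)) <= eps / 2 / J.+1%:R.
  by apply: (tau_delta_cauchy_dominated i0 (eD j) (eZ j) (edom j) uC e2).
exists (\max_(j < J) N j) => m n Nm Nn p [Wp /W'P[ip vp]].
pose v : I := exist _ (chart i p - c) vp.
have h8 : r / (r / 8) = 8 by field; rewrite gt_eqF.
have bl k : bholo 8 K (line (u k) (sval v)).
  by have := bline _ _ _ _ v (uC.1 k) rP r0 (WK k); move: (sval v) => w; rewrite h8.
pose g z := line (u m) (sval v) z + -1 *: line (u n) (sval v) z.
have bg : bholo 8 (K + K) g.
  apply: bholoD (bl m) _; have := bholoZ (-1) (bl n); by rewrite cabsN cabs1 mul1r.
have -> : u m p - u n p = g 1.
  by rewrite /g /line /= scale1r scaleN1r (addrC c) subrK chart_invK.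
apply: le_trans (dquot_expansion g J) _.
have tail : nrm (iter J (@dquot R F) g 1) <= eps / 2.
  apply: le_trans JP; have lt8 : (0 : R) < 8 by [].
  have := (bholo_iter_dquot J lt8 bg).2 1; rewrite cabs1 (_ : 4 / 8 = 2^-1); last by field.
  by apply; lra.
have head : \sum_(j < J) nrm (iter j (@dquot R F) g 0) <= eps / 2.
  have le : \sum_(j < J) nrm (iter j (@dquot R F) g 0) <= \sum_(j < J) (eps / 2 / J.+1%:R).
    apply: ler_sum => j _.
    have -> : iter j (@dquot R F) g 0 = e j v (u m) - e j v (u n).
      have lt8 : (0 : R) < 8 by [].
      rewrite (iter_dquotD j lt8 (bl m) (bholoZ (-1) (bl n))) (iter_dquotZ (-1) j lt8 (bl n)).
      by rewrite scaleN1r.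
    by apply: NP; [apply: leq_trans Nm|apply: leq_trans Nn]; apply: (leq_bigmax (F := fun j : 'I_J => N j)).
  apply: le_trans le _; rewrite sumr_const card_ord -[leLHS]mulr_natr mulrAC ler_pdivrMr //.
  by rewrite ler_wpM2l ?ler_nat //; lra.
lra.
Qed.
End LocalBounds.

(** * Sequential completeness *)

Section LocallyUniformLimits.
Variables (R : realType) (M : topologicalType) (A : cBanachManifold R M).
Variable F : completeNormedModType R[i].
Local Notation C := R[i].

(** On every complex line through a point [weierstrass] gives a derivative [L v]. It is linear in v
    as a pointwise limit of differentials, bounded by the Cauchy estimate, and has a quadratic
    remainder uniform over directions. *)
Lemma holo_map_locally_uniform_limit (u : nat -> M -> F) (f : M -> F) :
  (forall n, holo_map A (u n)) ->
  (forall x, exists W, [/\ open W, W x, exists K, forall n p, W p -> nrm (u n p) <= K &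
    forall eps : R, 0 < eps -> exists N, forall n, (N <= n)%N -> forall p, W p ->
      nrm (u n p - f p) <= eps]) ->
  holo_map A f.
Proof.
move=> uh uf i.
(* A chart with empty domain offers no default point for [chart_inv]. *)
have [[x ix]|noi] := pselect (exists x, dom i x); last first.
  by exists (fun=> 0); split=> [m [p ip]|p ip]; case: noi; exists p.
exists (f \o chart_inv x); split=> [m [p ip <-]|p ip]; last by rewrite /= chart_invK.
set c := chart i p.
have [W [Wo Wp [K WK] Wf]] := uf p.
have [r r0 rP] := chart_ball_ex Wo Wp ip.
have K0 : 0 <= K by apply: le_trans (nrm_ge0 _) (WK 0%N p Wp).
have /choice[D DP] n := holo_map_frechet x (uh n) ip.
pose line h v := fun z : C => (h \o chart_inv x) (c + z *: v) : F.
have DE n v : cderiv (line (u n) v) 0 = D n v by apply: cderivE; apply: DP.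
have weier v s : 0 < s -> s * nrm v <= r -> exists l, nrm_cvg (fun n => D n v) l /\
    forall z, cabs z < s / 4 ->
      nrm (line f v z - line f v 0 - z *: l) <= 64 * K / s ^+ 2 * cabs z ^+ 2.
  move=> s0 sv.
  have bl n : bholo s K (line (u n) v) by apply: bholo_line rP (WK n) r0 sv; apply: uh.
  have [|l [Dl lP]] := weierstrass (g := line f v) s0 bl.
    move=> eps /Wf[N NP]; exists N => n /NP Nn z zs; rewrite /line /=.
    have [|q [Wq iq <-]] := rP (c + z *: v); last by rewrite chart_invK //; apply: Nn.
    rewrite addrAC subrr add0r nrmZ; have := nrm_ge0 v.
    rewrite le_eqVlt => /orP[/eqP <-|v0]; first by rewrite mulr0.
    by apply: lt_le_trans sv; rewrite ltr_pM2r.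
  exists l; split=> // e /Dl[N NP]; exists N => n /NP; by rewrite DE.
have /choice[L LP] v : exists l, nrm_cvg (fun n => D n v) l.
  have v1 : 0 < nrm v + 1 by have := nrm_ge0 v; lra.
  have [|l []] := weier v (r / (nrm v + 1)) (divr_gt0 r0 v1); last by exists l.
  by rewrite mulrAC ler_pdivrMr // ler_wpM2l ?(ltW r0) //; lra.
have Llin : linear L.
  move=> a v w; apply: nrm_cvg_unique (LP _) _ => e e0.
  have [N NP] := nrm_cvgD (nrm_cvgZ a (LP v)) (LP w) e0.
  by exists N => n /NP; rewrite linearP.
have L0 : L 0 = 0.
  by have := Llin (-1) 0 0; rewrite scaler0 addr0 scaleN1r addrC subrr.
pose B := Num.max (4 * K / r) (64 * K / r ^+ 2).
have B1 : 4 * K / r <= B by rewrite le_max lexx.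
have B2 : 64 * K / r ^+ 2 <= B by rewrite le_max lexx orbT.
have B0 : 0 <= B by apply: le_trans B1; rewrite !mulr_ge0 // invr_ge0 ltW.
have r4 : 0 < r / 4 by lra.
apply: (nrm_differentiable r4 B0 Llin) => h.
  have [->|h0] := eqVneq h 0; first by rewrite L0 !nrm0 mulr0.
  have nh : 0 < nrm h.
    by rewrite lt_def nrm_ge0 andbT; apply: contra h0 => /eqP/nrm_eq0/eqP.
  apply: le_trans (ler_wpM2r (ltW nh) B1).
  apply: nrm_cvg_le (LP h) _ => n; rewrite -DE.
  have s0 : 0 < r / nrm h by rewrite divr_gt0.
  have bl : bholo (r / nrm h) K (line (u n) h).
    by apply: (bholo_line _ (uh n) rP (WK n) r0); rewrite divfK // gt_eqF.
  have -> : 4 * K / r * nrm h = 2 * K / (r / nrm h / 2) by field; rewrite !gt_eqF.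
  apply: cderiv_le bl; rewrite ?cabs0; lra.
move=> hr; have [->|h0] := eqVneq h 0.
  by rewrite addr0 L0 subr0 subrr !nrm0 expr2 !mulr0.
have nh : 0 < nrm h.
  by rewrite lt_def nrm_ge0 andbT; apply: contra h0 => /eqP/nrm_eq0/eqP.
(* The disc of radius r / |h| fills the ball in direction h, and z = 1 lies in its inner quarter
   because |h| < r / 4. *)
have [|l [lD]] := weier h (r / nrm h) (divr_gt0 r0 nh).
  by rewrite divfK // gt_eqF.
rewrite (nrm_cvg_unique lD (LP h)) => /(_ 1).
rewrite cabs1 /line scale1r scale0r addr0 scale1r expr1n mulr1 => H.
apply: le_trans (H _) _.
  by rewrite mulrAC ltr_pdivlMr // mul1r.
have -> : 64 * K / (r / nrm h) ^+ 2 = 64 * K / r ^+ 2 * nrm h ^+ 2.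
  by field; rewrite !gt_eqF.
by rewrite ler_wpM2r ?sqr_ge0.
Qed.

Lemma second_countable_cover (good : set M -> Prop) : @second_countable M ->
  good set0 -> (forall V W, V `<=` W -> good W -> good V) ->
  (forall x, exists W, [/\ open W, W x & good W]) ->
  exists U : nat -> set M, countable_open_cover U /\ forall k, good (U k).
Proof.
move=> [B /countable_injP[idx idx_inj] [Bo Bbase]] good0 goodS goodx.
pose U n := xget set0 [set V | [/\ B V, good V & idx V = n]].
exists U; split; first split=> [k|y].
- by rewrite /U; case: xgetP => [V _ [/Bo]|_] //; apply: open0.
- have [W [Wo Wy Wg]] := goodx y.
  have /Bbase[V [BV Vy] VW] : nbhs y W by apply: open_nbhs_nbhs.
  have gV := goodS _ _ VW Wg; exists (idx V).
  have [BE _ iE] := @xgetPex _ set0 [set V' | [/\ B V', good V' & idx V' = idx V]]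
    (ex_intro _ V (And3 BV gV erefl)).
  by rewrite (_ : U _ = V) //; apply: idx_inj => //; rewrite inE.
by move=> k; rewrite /U; case: xgetP => [V _ []|_].
Qed.
End LocallyUniformLimits.

Theorem theorem7p1 (R : realType) (M : topologicalType)
  (A : cBanachManifold R M) (F : completeNormedModType (R[i])) :
  hausdorff_space M -> @second_countable M ->
  tau_delta_sequentially_complete A F.
Proof.
move=> _ Msc u uC; have uh := uC.1.
have loc x := tau_delta_cauchy_locally_uniform uC x Msc.
have /choice[f fP] x : exists l, nrm_cvg (fun n => u n x) l.
  apply: nrm_complete => e e0; have [W [_ Wx _ Wu]] := loc x.
  have [N NP] := Wu _ e0; exists N => m n Nm Nn; exact: NP.
have locf x : exists W, [/\ open W, W x, exists K, forall n p, W p -> nrm (u n p) <= K &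
    forall eps : R, 0 < eps -> exists N, forall n, (N <= n)%N -> forall p, W p ->
      nrm (u n p - f p) <= eps].
  have [W [Wo Wx WK Wu]] := loc x; exists W; split=> // eps /Wu[N NP].
  exists N => n Nn p Wp.
  (* The Cauchy bound passes to the limit in its second index; the shift by N puts every term in the
     range of the bound. *)
  have cu : nrm_cvg (fun m => u n p + -1 *: u (m + N)%N p) (u n p + -1 *: f p).
    move=> e /(fP p)[N' NP']; exists N' => m Nm.
    rewrite !scaleN1r opprD addrACA subrr add0r opprK addrC nrmBC.
    by apply: NP'; apply: leq_trans (leq_addr _ _).
  move: cu; rewrite scaleN1r => /nrm_cvg_le; apply=> m; rewrite scaleN1r.
  by apply: NP; rewrite ?leq_addl.
have fh : holo_map A f := holo_map_locally_uniform_limit uh locf.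
pose good W := (exists K : R, forall n p, W p -> nrm (u n p) <= K) /\
  forall eps : R, 0 < eps -> exists N, forall n, (N <= n)%N -> forall p, W p ->
      nrm (u n p - f p) <= eps.
have [||x|U [Uc Ug]] := second_countable_cover (good := good) Msc.
- by split; [exists 0|move=> e _; exists 0%N].
- move=> V W VW [[K WK] Wu]; split; first by exists K => n p /VW; apply: WK.
  by move=> e /Wu[N NP]; exists N => n Nn p /VW; apply: NP.
- by have [W [Wo Wx WK Wu]] := locf x; exists W.
exists f; split=> // p [_ pcont] eps eps0.
(* Continuity of p on the space of this single cover suffices, since all u_n - f belong to it. *)
have [k [d [d0 kP]]] := pcont U Uc _ eps0.
have d2 : 0 < d / 2 by lra.
have /choice[N NP] j := (Ug j).2 _ d2.
have supnorm_le j h B : (forall q, U j q -> nrm (h q : F) <= B) -> (supnorm (U j) h <= B%:E)%E.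
  by move=> hB; apply: ge_ereal_sup => _ [q Uq <-]; rewrite lee_fin; apply: hB.
exists (\max_(j < k) N j) => n Nn; apply: kP.
  split=> [|j]; first exact: holo_mapB.
  have [K UK] := (Ug j).1; have [N' /(_ _ (leqnn _)) NP'] := (Ug j).2 _ (ltr01 : 0 < 1 :> R).
  (* On this member f is within 1 of some u_N', hence bounded by K + 1. *)
  apply: le_lt_trans (ltry (K + (K + 1))); apply: supnorm_le => q Uq.
  apply: le_trans (nrmB _ _) _; apply: lerD; first exact: UK.
  have -> : f q = u N' q - (u N' q - f q) by rewrite opprB addrC subrK.
  by apply: le_trans (nrmB _ _) _; apply: lerD; [apply: UK|apply: NP'].
(* Half of d makes room for the strict inequality, which a pointwise bound by d would not give for
   the supremum. *)
move=> j jk; apply: (@le_lt_trans _ _ (d / 2)%:E); last by rewrite lte_fin; lra.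
apply: supnorm_le => q; apply: NP; apply: leq_trans Nn.
exact: (leq_bigmax (F := fun j : 'I_k => N j) (Ordinal jk)).
Qed.
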